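(* Let $G$ be a closed graph on the vertex set $[n]$, labeled so that it is closed with respect to its labeling, and let $G_1,\ldots,G_r$ be the connected components of $G$. Then $$\operatorname{reg}(S/J_G)=\operatorname{reg}(S/\operatorname{in}_{\mathrm{lex}}(J_G))=\ell_1+\cdots+\ell_r,$$ where, for $1\le i\le r$, $\ell_i$ is the length of the longest induced path of $G_i$.
   Context: Let $K$ be a field and $S=K[x_1,\ldots,x_n,y_1,\ldots,y_n]$ the standard graded polynomial ring in $2n$ variables. Graphs are finite and simple. For a graph $G$ on $[n]=\{1,\ldots,n\}$ with edge set $E(G)$, the binomial edge ideal of $G$ is $J_G=(x_iy_j-x_jy_i : \{i,j\}\in E(G),\ i<j)\subset S$. $\operatorname{in}_{\mathrm{lex}}(J_G)$ denotes the initial ideal of $J_G$ with respect to the lexicographic order induced by $x_1>\cdots>x_n>y_1>\cdots>y_n$, and $\operatorname{reg}$ denotes Castelnuovo--Mumford regularity over $S$. The graph $G$ is closed with respect to its given labeling if for all distinct edges $\{i,j\},\{i,k\}\in E(G)$ such that either $i<j$ and $i<k$, or $i>j$ and $i>k$, one has $\{j,k\}\in E(G)$ (equivalently, the generators $x_iy_j-x_jy_i$ of $J_G$ form a Gröbner basis with respect to the lexicographic order induced by $x_1>\cdots>x_n>y_1>\cdots>y_n$). $G$ is closed if it is closed with respect to some labeling of its vertices. The length of a path is its number of edges (a single vertex is a path of length $0$); an induced path is a path that is an induced subgraph. *)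

(* Defs.v *)
From HB Require Import structures.
From mathcomp Require Import all_boot all_order all_algebra.
From mathcomp Require Export mpoly.

Set Implicit Arguments.
Unset Strict Implicit.
Unset Printing Implicit Defensive.

Import GRing.Theory.

Local Open Scope ring_scope.

(* Ideals of a polynomial ring are Prop-valued predicates. *)

Section Ideals.
Variables (K : fieldType) (N : nat).
Local Notation S := {mpoly K[N]}.

Definition ideal_gen (A : S -> Prop) (p : S) : Prop :=
  exists (k : nat) (c a : 'I_k -> S),
    (forall t, A (a t)) /\ p = \sum_(t < k) c t * a t.

Definition irrelevant_ideal : S -> Prop :=
  ideal_gen (fun p => exists i : 'I_N, p = 'X_i).

(* Pure lexicographic order with 'X_0 > 'X_1 > ... (the order that the library
   puts on monomials compares total degrees first). *)
Definition lexlt (m m' : 'X_{1..N}) : bool :=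
  [exists i : 'I_N,
     (m i < m' i)%N && [forall k : 'I_N, (k < i)%N ==> (m k == m' k)]].

Definition lex_lead (p : S) (m : 'X_{1..N}) : Prop :=
  m \in msupp p /\ (forall m', m' \in msupp p -> m' != m -> lexlt m' m).

Definition in_lex (I : S -> Prop) : S -> Prop :=
  ideal_gen (fun q => exists (f : S) (m : 'X_{1..N}),
    [/\ I f, lex_lead f m & q = 'X_[m]]).

End Ideals.

Section Regularity.
Variables (K : fieldType) (N : nat).
Local Notation S := {mpoly K[N]}.

(* Graded free modules F_i of finite rank, with a basis in degrees [gdeg i],
   and maps F_(i+1) -> F_i, v |-> v *m gdiff i, on row vectors. The column
   [gaug] lifts an augmentation F_0 -> S/A to a map F_0 -> S. *)
Record graded_free_seq := GradedFreeSeq {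
  grank : nat -> nat;
  gdeg : forall i, 'I_(grank i) -> nat;
  gdiff : forall i, 'M[S]_(grank i.+1, grank i);
  gaug : 'cV[S]_(grank 0)
}.

(* p lies in the degree-j component of the shifted module S(-d) *)
Definition homog_shift (d j : nat) (p : S) : bool :=
  if (d <= j)%N then p \is (j - d)%N.-homog else p == 0.

Definition homog_elt (P : graded_free_seq) (i j : nat)
    (v : 'rV[S]_(grank P i)) : Prop :=
  forall k, homog_shift (@gdeg P i k) j (v 0 k).

Definition mod_ideal (B : S -> Prop) (r : nat) (v : 'rV[S]_r) : Prop :=
  forall k, B (v 0 k).

(* ... -> F_1 -> F_0 -> S/A -> 0 is exact with maps of degree 0 *)
Definition graded_free_resolution (P : graded_free_seq) (A : S -> Prop) : Prop :=
  [/\ forall i k, homog_elt (@gdeg P i.+1 k) (row k (gdiff P i)),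
      forall k, gaug P k 0 \is (@gdeg P 0%N k).-homog,
      exists v : 'rV[S]_(grank P 0), A ((v *m gaug P) 0 0 - 1),
      forall v : 'rV[S]_(grank P 0),
        A ((v *m gaug P) 0 0) <-> exists w, v = w *m gdiff P 0
    & forall i (v : 'rV[S]_(grank P i.+1)),
        v *m gdiff P i = 0 <-> exists w, v = w *m gdiff P i.+1].

(* Cycles and boundaries of the complex P (x) S/B, on representatives *)
Definition tensor_cycle (P : graded_free_seq) (B : S -> Prop) (i : nat) :
    'rV[S]_(grank P i) -> Prop :=
  match i with
  | 0 => fun _ => True
  | i'.+1 => fun v => mod_ideal B (v *m gdiff P i')
  end.

Definition tensor_boundary (P : graded_free_seq) (B : S -> Prop) (i : nat)
    (v : 'rV[S]_(grank P i)) : Prop :=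
  exists w : 'rV[S]_(grank P i.+1), mod_ideal B (v - w *m gdiff P i).

(* H_i(P (x) S/B)_j <> 0. When P is a graded free resolution of S/A and B is a
   homogeneous ideal, this is Tor_i(S/A, S/B)_j <> 0. *)
Definition tor_neq0 (P : graded_free_seq) (B : S -> Prop) (i j : nat) : Prop :=
  exists v : 'rV[S]_(grank P i),
    [/\ homog_elt j v, tensor_cycle B v & ~ tensor_boundary B v].

(* reg(S/I) = max {j - i : Tor_i(K, S/I)_j <> 0} for I homogeneous, where Tor is
   computed from a graded free resolution of K = S/(X_0, ..., X_(N-1)); the
   choice of the resolution is irrelevant. *)
Definition is_reg (I : S -> Prop) (r : int) : Prop :=
  exists P : graded_free_seq,
    [/\ graded_free_resolution P (@irrelevant_ideal K N),
        exists i j : nat, tor_neq0 P I i j /\ j%:Z - i%:Z = r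
      & forall i j : nat, tor_neq0 P I i j -> j%:Z - i%:Z <= r].

End Regularity.

(* The x-variables come first, so that lexlt is induced by
   x_1 > ... > x_n > y_1 > ... > y_n. *)
Definition xvar (K : fieldType) (n : nat) (i : 'I_n) : {mpoly K[(n + n)%N]} :=
  'X_(lshift n i).
Definition yvar (K : fieldType) (n : nat) (i : 'I_n) : {mpoly K[(n + n)%N]} :=
  'X_(rshift n i).

(* A simple graph on [n] is a symmetric irreflexive e : rel 'I_n. *)

Definition binomial_edge_ideal (K : fieldType) (n : nat) (e : rel 'I_n) :
    {mpoly K[(n + n)%N]} -> Prop :=
  ideal_gen (fun p => exists i j : 'I_n,
    [/\ (i < j)%N, e i j & p = xvar K i * yvar K j - xvar K j * yvar K i]).

Arguments binomial_edge_ideal K [n] e _.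

Definition closed_labeling (n : nat) (e : rel 'I_n) : Prop :=
  forall i j k : 'I_n, j != k -> e i j -> e i k ->
    ((i < j) && (i < k) || (j < i) && (k < i))%N -> e j k.

Definition components (n : nat) (e : rel 'I_n) : {set {set 'I_n}} :=
  equivalence_partition (connect e) [set: 'I_n].

(* An induced path of length l is given by its l + 1 vertices in order. *)
Definition induced_path (n : nat) (e : rel 'I_n) (l : nat)
    (p : l.+1.-tuple 'I_n) : bool :=
  uniq p && [forall a : 'I_l.+1, forall b : 'I_l.+1,
    e (tnth p a) (tnth p b) == ((b == a.+1 :> nat) || (a == b.+1 :> nat))].

(* The length is < n because the vertices are distinct. *)
Definition longest_induced_path (n : nat) (e : rel 'I_n) (C : {set 'I_n}) : nat :=
  \max_(l < n | [exists p : l.+1.-tuple 'I_n,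
                   induced_path e p && all (fun v => v \in C) p]) l.

(* Main.v *)
Require Import Defs.
From HB Require Import structures.
From mathcomp Require Import all_boot all_order all_algebra.
From mathcomp Require Import zify ring.
From mathcomp.multinomials Require Import ssrcomplements.
From Stdlib Require Import Classical.

Set Implicit Arguments.
Unset Strict Implicit.
Unset Printing Implicit Defensive.

Import GRing.Theory Num.Theory.
Local Open Scope ring_scope.

(** A chain of the Koszul complex of S / I is represented by a family of polynomials
    indexed by the sets of variables; in homological degree i and internal degree j
    its coefficients have degree j - i. So reg (S / I) <= r as soon as, for
    every c > r, each cycle with coefficients of degree c is a boundary modulo I
    ([koszul_vanish]); homological degrees can be forgotten
    ([is_reg_of_koszul_vanish]). What remains is to bound, above and below, the
    degrees c where this vanishing fails, for J_G and for its initial ideal.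

    Initial ideal. Modulo J_G a monomial divisible by x_i y_j, where i < j is an
    edge, can be rewritten with x_j y_i in place of x_i y_j. Closedness makes
    this rewriting locally confluent, so normal forms are invariants of
    monomials modulo J_G, and in_lex (J_G) is generated by the x_i y_j
    ([in_lex_edge_ideal]). The rewriting also lowers an additive integer weight, and
    a filtration by this weight carries vanishing from the initial ideal to J_G
    ([koszul_vanish_initial]). It is thus enough to bound the regularity from above
    for the monomial ideal and from below for J_G.

    Upper bound. The monomial ideal is the edge ideal of the bipartite graph joining
    x_i to y_j for every edge i < j. Taking out one variable x_i at a time by the
    colon ideal and the sum with (x_i) shows that its regularity is at most the
    largest size of an induced matching, because closedness makes the
    neighbourhoods of the x_i nested when seen from a minimal y_j
    ([koszul_vanish_edge_var]). Within one component an induced matching of size m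
    can be turned into an induced path with m edges ([matching_longest]).

    Lower bound. Choose a longest induced path in each component and list their
    vertices one path after the other. The edges of these paths give l linear
    Koszul chains whose boundaries are generators of J_G up to sign, and the product of the
    chains is a cycle of degree (l, 2 l). A linear functional on S kills J_G, and,
    composed with l contractions, kills all boundaries, but takes the value 1 on the
    cycle ([not_koszul_vanish_edge_ideal]). The functional comes from
    specializing the two variables attached to an edge t of a path to one variable
    z_t, and the other variables to 0: J_G becomes the complete intersection
    (z_t ^ 2 - z_(t-1) z_(t+1)), and the functional is the one that is dual to its
    socle, spanned by the product of the z_t. *)

(** * Coefficients, monomial ideals and generated ideals *)

Section Coefficients.
Variables (K : fieldType) (N : nat).
Local Notation S := {mpoly K[N]}.
Implicit Types (p q : S) (m : 'X_{1..N}).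

Lemma coeff_ge_msize p m : (msize p <= mdeg m)%N -> p@_m = 0.
Proof.
move=> le; apply/eqP; rewrite mcoeff_eq0; apply: contraL le => /msize_mdeg_lt.
by rewrite ltnNge.
Qed.

Lemma coeff_sum_bounded (E : 'X_{1..N} -> K) b :
    (forall m, (b <= mdeg m)%N -> E m = 0) ->
  forall m, (\sum_(m : 'X_{1..N < b}) (E m *: 'X_[m]) : S)@_m = E m.
Proof.
move=> E0 m; case: (ltnP (mdeg m) b) => [/mcoeff_mpoly|le]; first exact.
rewrite E0 // raddf_sum big1 //= => i _; rewrite mcoeffZ mcoeffX.
case: eqP => [eq|_]; last by rewrite mulr0.
by move: le; rewrite -eq leqNgt bmdeg.
Qed.

(** The part of a polynomial supported on the monomials in Q; every grading used
    below is split with this one projection. *)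
Definition mfilter (Q : pred 'X_{1..N}) p : S :=
  \sum_(m : 'X_{1..N < msize p}) ((if Q m then p@_m else 0) *: 'X_[m]).

Lemma coeff_mfilter Q p m : (mfilter Q p)@_m = if Q m then p@_m else 0.
Proof.
rewrite [LHS](@coeff_sum_bounded (fun m => if Q m then p@_m else 0)) //.
by move=> m' /coeff_ge_msize ->; case: ifP.
Qed.

(** Division by 'X_k that drops the monomials not divisible by 'X_k; a K-linear left
    inverse of the multiplication by 'X_k. *)
Definition mdivX (k : 'I_N) p : S :=
  \sum_(m : 'X_{1..N < msize p}) (p@_(m + U_(k)) *: 'X_[m]).

Lemma coeff_mdivX k p m : (mdivX k p)@_m = p@_(m + U_(k)).
Proof.
rewrite [LHS](@coeff_sum_bounded (fun m => p@_(m + U_(k)))) // => m' le.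
by apply: coeff_ge_msize; rewrite mdegD (leq_trans le) ?leq_addr.
Qed.

Lemma coeff_XM k p m : ('X_k * p)@_(m + U_(k)) = p@_m.
Proof. by rewrite mulrC addmC mcoeffMX. Qed.

Lemma mnm_subK (k : 'I_N) m : (0 < m k)%N -> (m - U_(k) + U_(k))%MM = m.
Proof.
move=> gt0; rewrite submK //; by apply/mnm_lepP => i; rewrite mnm1E; case: eqP => // <-.
Qed.

Lemma coeff_XM_eq0 k p m : m k = 0%N -> ('X_k * p)@_m = 0.
Proof.
move=> m0; apply/eqP; rewrite mcoeff_eq0; apply/negP => /msuppM_le.
case/allpairsP => -[m1 m2] /= [/mem_msuppXP <- _ eqm].
by move: m0; rewrite eqm mnmDE mnm1E eqxx.
Qed.

Lemma coeff_XM_if k p m :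
  ('X_k * p)@_m = if (0 < m k)%N then p@_(m - U_(k)) else 0.
Proof.
case: ifP => [/mnm_subK {1}<-|/negbT]; first by rewrite coeff_XM.
by rewrite lt0n negbK => /eqP /coeff_XM_eq0.
Qed.

Lemma mfilterXM Q k p :
  mfilter Q ('X_k * p) = 'X_k * mfilter (fun m => Q (m + U_(k))%MM) p.
Proof.
apply/mpolyP => m; rewrite coeff_mfilter !coeff_XM_if coeff_mfilter.
by case: (ltnP 0 (m k)) => [/mnm_subK ->|] //; case: ifP.
Qed.

Definition linext (f : 'X_{1..N} -> K) p : K :=
  \sum_(m <- msupp p) p@_m * f m.

Lemma linext_bounded f p b : (msize p <= b)%N ->
  linext f p = \sum_(m : 'X_{1..N < b}) p@_m * f m.
Proof.
move=> le; pose I : subFinType _ := 'X_{1..N < b}.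
rewrite /linext (big_mksub I) /=; first last.
- by move=> x /msize_mdeg_lt/leq_trans/(_ le).
- by rewrite msupp_uniq.
by rewrite big_rmcond //= => j /memN_msupp_eq0 ->; rewrite mul0r.
Qed.

Lemma linext_is_additive f : zmod_morphism (linext f).
Proof.
move=> p q; pose b := maxn (msize (p - q)) (maxn (msize p) (msize q)).
rewrite !(@linext_bounded f _ b) ?leq_max ?leqnn ?orbT // -sumrB.
by apply: eq_bigr => i _; rewrite mcoeffB mulrBl.
Qed.

HB.instance Definition _ f :=
  GRing.isZmodMorphism.Build S K (linext f) (linext_is_additive f).

Lemma linextZ f c p : linext f (c *: p) = c * linext f p.
Proof.
rewrite !(@linext_bounded f _ (maxn (msize (c *: p)) (msize p))) ?leq_max ?leqnn ?orbT //.
by rewrite mulr_sumr; apply: eq_bigr => i _; rewrite mcoeffZ mulrA.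
Qed.

Lemma linextX f m : linext f 'X_[m] = f m.
Proof. by rewrite /linext msuppX big_seq1 mcoeffX eqxx mul1r. Qed.

Lemma linextXM f a p : linext f ('X_[a] * p) = linext (fun m => f (a + m)%MM) p.
Proof.
rewrite [p in LHS]mpolyE mulr_sumr raddf_sum; apply: eq_bigr => m _ /=.
by rewrite -scalerAr linextZ -mpolyXD linextX.
Qed.

Lemma eq_linext f g p : f =1 g -> linext f p = linext g p.
Proof. by move=> eq; apply: eq_bigr => m _; rewrite eq. Qed.

Definition upclosed (U : pred 'X_{1..N}) := forall m m', U m -> U (m + m')%MM.
(** The ideal spanned by the monomials in U, given by membership of all terms, so
    that it can be tested coefficientwise. *)
Definition monomial_ideal (U : pred 'X_{1..N}) p : Prop :=
  forall m, p@_m != 0 -> U m.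

Definition is_ideal (I : S -> Prop) : Prop :=
  [/\ I 0, forall p q, I p -> I q -> I (p + q) & forall p q, I p -> I (q * p)].

Lemma is_ideal_sum I (T : Type) (r : seq T) (P : pred T) (F : T -> S) :
  is_ideal I -> (forall t, P t -> I (F t)) -> I (\sum_(t <- r | P t) F t).
Proof. by case=> I0 ID _ IF; elim/big_ind: _. Qed.

Lemma is_idealN I p : is_ideal I -> I p -> I (- p).
Proof. by case=> _ _ IM Ip; rewrite -mulN1r; apply: IM. Qed.

Lemma is_idealB I p q : is_ideal I -> I p -> I q -> I (p - q).
Proof. by move=> Iid; case: (Iid) => _ ID _ Ip Iq; apply: ID => //; apply: is_idealN. Qed.

Lemma monomial_is_ideal U : upclosed U -> is_ideal (monomial_ideal U).
Proof.
move=> up; split=> [m|p q Ip Iq m|p q Ip m]; first by rewrite mcoeff0 eqxx.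
- rewrite mcoeffD; case: (eqVneq p@_m 0) => [->|/Ip] //.
  by rewrite add0r => /Iq.
rewrite -mcoeff_msupp => /msuppM_le /allpairsP[[m1 m2]] /= [_ in2 ->].
by rewrite addmC; apply: up; apply: Ip; rewrite -mcoeff_msupp.
Qed.

Lemma monomial_mfilter U p : monomial_ideal U (mfilter U p).
Proof. by move=> m; rewrite coeff_mfilter; case: ifP => //; rewrite eqxx. Qed.

Lemma ideal_gen_is_ideal (A : S -> Prop) : is_ideal (ideal_gen A).
Proof.
split.
- by exists 0%N, (fun=> 0), (fun=> 0); split=> [[]//|]; rewrite big_ord0.
- move=> p q [k1 [c1 [a1 [A1 ->]]]] [k2 [c2 [a2 [A2 ->]]]].
  exists (k1 + k2)%N.
  exists (fun t => match split t with inl i => c1 i | inr i => c2 i end).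
  exists (fun t => match split t with inl i => a1 i | inr i => a2 i end).
  split=> [t|]; first by case: (split t).
  rewrite big_split_ord; congr (_ + _); apply: eq_bigr => i _.
    by rewrite -[lshift _ _]/(unsplit (inl i)) unsplitK.
  by rewrite -[rshift _ _]/(unsplit (inr i)) unsplitK.
- move=> p q [k [c [a [Aa ->]]]]; exists k, (fun t => q * c t), a; split=> //.
  by rewrite mulr_sumr; apply: eq_bigr => t _; rewrite mulrA.
Qed.

Lemma ideal_gen_mem (A : S -> Prop) p : A p -> ideal_gen A p.
Proof.
move=> Ap; exists 1%N, (fun=> 1), (fun=> p).
by split=> //; rewrite big_ord1 mul1r.
Qed.

Lemma ideal_gen_sub (A I : S -> Prop) p :
  is_ideal I -> (forall q, A q -> I q) -> ideal_gen A p -> I p.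
Proof.
move=> Iid AI [k [c [a [Aa ->]]]]; apply: is_ideal_sum => // t _.
by case: Iid => _ _; apply; apply: AI.
Qed.

End Coefficients.

(** * The Koszul complex with its wedge and contraction operators *)

Section Koszul.
Variables (K : fieldType) (N : nat).
Local Notation S := {mpoly K[N]}.
Local Notation E := {ffun {set 'I_N} -> S}.
Implicit Types (A B : {set 'I_N}) (k l : 'I_N) (p q : S) (v w : E).

(** The sign that moves the basis vector k to its place in the increasing wedge
    product over A. *)
Definition koszul_sign k A : S := (-1) ^+ #|[set a in A | (a < k)%N]|.

Lemma koszul_sign_sqr k A : koszul_sign k A * koszul_sign k A = 1.
Proof. by rewrite -expr2 sqrr_sign. Qed.

Lemma koszul_signU1 k A : koszul_sign k (k |: A) = koszul_sign k A.
Proof.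
congr (_ ^+ _); apply: eq_card => a; rewrite !inE.
by case: eqP => // ->; rewrite ltnn !andbF.
Qed.

Lemma koszul_signD1 k A : koszul_sign k (A :\ k) = koszul_sign k A.
Proof.
by rewrite -koszul_signU1 -(koszul_signU1 k A); congr koszul_sign; apply/setP => a;
  rewrite !inE; case: eqP.
Qed.

Lemma koszul_signU k l A : l \notin A ->
  koszul_sign k (l |: A) = (-1) ^+ (l < k)%N * koszul_sign k A.
Proof.
move=> lA; rewrite /koszul_sign -exprD; congr (_ ^+ _).
case: ltnP => lk.
  rewrite (_ : [set a in _ | _] = l |: [set a in A | (a < k)%N]).
    by rewrite cardsU1 inE (negPf lA).
  by apply/setP => a; rewrite !inE; case: eqP => // ->; rewrite lk.
congr #|pred_of_set _|; apply/setP => a; rewrite !inE.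
by case: eqP => // ->; rewrite (negPf lA) ltnNge lk.
Qed.

Lemma koszul_signD k l A : l \in A ->
  koszul_sign k A = (-1) ^+ (l < k)%N * koszul_sign k (A :\ l).
Proof. by move=> lA; rewrite -{1}(setD1K lA) koszul_signU // !inE eqxx. Qed.

Lemma sign_lt_swap k l : k != l -> (-1) ^+ (k < l)%N = - ((-1) ^+ (l < k)%N : S).
Proof. by rewrite neq_ltn => /orP[] lt; rewrite lt ltnNge ltnW //= ?opprK. Qed.

Definition contract k v : E :=
  [ffun A : {set 'I_N} => if k \in A then 0 else koszul_sign k A * v (k |: A)].
Definition wedge k v : E :=
  [ffun A : {set 'I_N} => if k \in A then koszul_sign k A * v (A :\ k) else 0].
Definition scale_by p v : E := [ffun A : {set 'I_N} => p * v A].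
(** The complex is kept as a single module, the functions from sets of variables to
    S, and its differential is the contraction with (x_1, ..., x_N). All identities
    then follow from the anticommutation rules of [contract] and [wedge]. *)
Definition koszul_d v : E := \sum_k scale_by 'X_k (contract k v).

Lemma contract_is_additive k : zmod_morphism (contract k).
Proof.
by move=> v w; apply/ffunP => A; rewrite !ffunE; case: ifP; rewrite ?subr0 // mulrBr.
Qed.
HB.instance Definition _ k := GRing.isZmodMorphism.Build E E (contract k) (contract_is_additive k).

Lemma wedge_is_additive k : zmod_morphism (wedge k).
Proof.
by move=> v w; apply/ffunP => A; rewrite !ffunE; case: ifP; rewrite ?subr0 // mulrBr.
Qed.
HB.instance Definition _ k := GRing.isZmodMorphism.Build E E (wedge k) (wedge_is_additive k).

Lemma scale_by_is_additive p : zmod_morphism (scale_by p).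
Proof. by move=> v w; apply/ffunP => A; rewrite !ffunE mulrBr. Qed.
HB.instance Definition _ p := GRing.isZmodMorphism.Build E E (scale_by p) (scale_by_is_additive p).

Lemma koszul_d_is_additive : zmod_morphism koszul_d.
Proof. by move=> v w; rewrite -sumrB; apply: eq_bigr => k _; rewrite !raddfB. Qed.
HB.instance Definition _ := GRing.isZmodMorphism.Build E E koszul_d koszul_d_is_additive.

Lemma contract_scale k p v : contract k (scale_by p v) = scale_by p (contract k v).
Proof. by apply/ffunP => A; rewrite !ffunE; case: ifP; rewrite ?mulr0 // mulrCA. Qed.

Lemma wedge_scale k p v : wedge k (scale_by p v) = scale_by p (wedge k v).
Proof. by apply/ffunP => A; rewrite !ffunE; case: ifP; rewrite ?mulr0 // mulrCA. Qed.

Lemma scale_byA p q v : scale_by p (scale_by q v) = scale_by (p * q) v.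
Proof. by apply/ffunP => A; rewrite !ffunE mulrA. Qed.

Lemma scale_byC p q v : scale_by p (scale_by q v) = scale_by q (scale_by p v).
Proof. by rewrite !scale_byA mulrC. Qed.

Lemma koszul_d_scale p v : koszul_d (scale_by p v) = scale_by p (koszul_d v).
Proof.
by rewrite /koszul_d raddf_sum; apply: eq_bigr => k _; rewrite contract_scale scale_byC.
Qed.

Lemma contract_contract k v : contract k (contract k v) = 0.
Proof. by apply/ffunP => A; rewrite !ffunE; case: ifP => //; rewrite setU11 mulr0. Qed.

Lemma contract_anticomm k l v : contract k (contract l v) = - contract l (contract k v).
Proof.
case: (eqVneq k l) => [<-|kl]; first by rewrite contract_contract oppr0.
apply/ffunP => A; rewrite !ffunE !in_setU1 (negPf kl) (eq_sym l k) (negPf kl) /=.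
case: (boolP (k \in A)) => kA; case: (boolP (l \in A)) => lA;
  rewrite ?mulr0 ?oppr0 //.
rewrite !koszul_signU // setUCA (sign_lt_swap kl).
have swap (a b c d : S) : b * (- a * c * d) = - (c * (a * b * d)) by ring.
exact: swap.
Qed.

Lemma contract_wedge k v : contract k (wedge k v) + wedge k (contract k v) = v.
Proof.
apply/ffunP => A; rewrite !ffunE; case: ifP => kA; rewrite ?setU11 ?setD11 ?add0r ?addr0.
  by rewrite setD1K // koszul_signD1 mulrA koszul_sign_sqr mul1r.
by rewrite setU1K ?kA // koszul_signU1 mulrA koszul_sign_sqr mul1r.
Qed.

Lemma contract_wedge_neq k l v : k != l -> contract k (wedge l v) + wedge l (contract k v) = 0.
Proof.
move=> kl; apply/ffunP => A; rewrite !ffunE !inE.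
rewrite (eq_sym l k) (negPf kl) /=.
case: (boolP (l \in A)) => lA; last by rewrite mulr0 addr0; case: ifP.
case: (boolP (k \in A)) => kA; first by rewrite mulr0 addr0.
have -> : (k |: A) :\ l = k |: (A :\ l).
  by apply/setP => a; rewrite !inE; case: (eqVneq a k) => // ->; rewrite kl.
rewrite (koszul_signD k lA) koszul_signU // (sign_lt_swap kl).
have factor (a b c d : S) :
  a * b * (- a * c * d) + c * (b * d) = (1 - a ^+ 2) * (b * c * d) by ring.
by rewrite [LHS]factor sqrr_sign subrr mul0r.
Qed.

Lemma koszul_d_contract k v : koszul_d (contract k v) = - contract k (koszul_d v).
Proof.
rewrite /koszul_d raddf_sum -sumrN; apply: eq_bigr => l _ /=.
by rewrite contract_scale contract_anticomm raddfN.
Qed.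

(** The hypothesis on the diagonal makes this valid in characteristic 2 too. *)
Lemma alternating_sum (V : zmodType) (F : 'I_N -> 'I_N -> V) :
    (forall k, F k k = 0) -> (forall k l, F k l = - F l k) ->
  \sum_k \sum_l F k l = 0.
Proof.
move=> F0 FN.
have split_sum k : \sum_l F k l =
    \sum_(l : 'I_N | (k < l)%N) F k l + \sum_(l : 'I_N | (l < k)%N) F k l.
  rewrite (bigID (fun l : 'I_N => (k < l)%N)) /=; congr (_ + _).
  rewrite (bigD1 k) ?ltnn //= F0 add0r; apply: eq_bigl => l.
  by rewrite -leqNgt ltn_neqAle andbC.
rewrite (eq_bigr _ (fun k _ => split_sum k)) big_split /=.
rewrite (exchange_big_dep xpredT) //= -big_split big1 // => l _ /=.
rewrite -big_split big1 // => k _ /=.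
by rewrite FN addNr.
Qed.

Lemma koszul_d_koszul_d v : koszul_d (koszul_d v) = 0.
Proof.
rewrite {1}/koszul_d (eq_bigr (fun k => \sum_l scale_by 'X_k (scale_by 'X_l (contract k (contract l v))))).
  apply: alternating_sum => [k|k l]; first by rewrite contract_contract !raddf0.
  by rewrite contract_anticomm !raddfN scale_byC.
move=> k _; rewrite /koszul_d [contract k _]raddf_sum [scale_by _ _]raddf_sum.
by apply: eq_bigr => l _ /=; rewrite contract_scale.
Qed.

(** Wedging with the k-th basis vector is a homotopy from multiplication by 'X_k
    to zero. *)
Lemma koszul_d_wedge k v : koszul_d (wedge k v) = scale_by 'X_k v - wedge k (koszul_d v).
Proof.
apply/eqP; rewrite eq_sym subr_eq; apply/eqP.
rewrite /koszul_d raddf_sum -big_split /= (bigD1 k) //=.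
rewrite wedge_scale -raddfD contract_wedge big1 ?addr0 // => l lk.
by rewrite wedge_scale -raddfD contract_wedge_neq // raddf0.
Qed.

Lemma koszul_dE v A : koszul_d v A =
  \sum_(k | k \notin A) 'X_k * (koszul_sign k A * v (k |: A)).
Proof.
rewrite /koszul_d sum_ffunE [RHS]big_mkcond; apply: eq_bigr => k _; rewrite !ffunE.
by case: ifP => //; rewrite mulr0.
Qed.

(** A projection that depends on the basis element A as well as on the monomial, so
    that it can follow the multidegree m + 1_A, which the differential preserves. *)
Definition restrict (Q : {set 'I_N} -> pred 'X_{1..N}) v : E :=
  [ffun A : {set 'I_N} => mfilter (Q A) (v A)].

Lemma mfilter_is_additive (Q : pred 'X_{1..N}) : zmod_morphism (@mfilter K N Q).
Proof.
move=> p q; apply/mpolyP => m; rewrite mcoeffB !coeff_mfilter mcoeffB.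
by case: ifP => //; rewrite subr0.
Qed.
HB.instance Definition _ (Q : pred 'X_{1..N}) :=
  GRing.isZmodMorphism.Build S S (@mfilter K N Q) (mfilter_is_additive Q).

Lemma restrict_is_additive Q : zmod_morphism (restrict Q).
Proof. by move=> v w; apply/ffunP => A; rewrite !ffunE raddfB. Qed.
HB.instance Definition _ Q := GRing.isZmodMorphism.Build E E (restrict Q) (restrict_is_additive Q).

Lemma coeff_restrict Q v A m : (restrict Q v A)@_m = if Q A m then (v A)@_m else 0.
Proof. by rewrite ffunE coeff_mfilter. Qed.

Lemma mfilter_koszul_sign (Q : pred 'X_{1..N}) k A p :
  mfilter Q (koszul_sign k A * p) = koszul_sign k A * mfilter Q p.
Proof. by rewrite /koszul_sign -signr_odd; case: odd; rewrite ?mulN1r ?raddfN ?mul1r. Qed.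

Lemma eq_mfilter (Q Q' : pred 'X_{1..N}) : Q =1 Q' -> @mfilter K N Q =1 mfilter Q'.
Proof. by move=> eq p; apply/mpolyP => m; rewrite !coeff_mfilter eq. Qed.

Lemma koszul_d_restrict Q Q' v :
    (forall k B m, k \notin B -> Q (k |: B) m = Q' B (m + U_(k))%MM) ->
  koszul_d (restrict Q v) = restrict Q' (koszul_d v).
Proof.
move=> eqQ; apply/ffunP => A; rewrite [RHS]ffunE !koszul_dE [RHS]raddf_sum.
apply: eq_bigr => k kA /=; rewrite mfilterXM ffunE mfilter_koszul_sign.
by congr (_ * (_ * _)); apply: eq_mfilter => m; rewrite eqQ.
Qed.

End Koszul.

(** * Vanishing of Koszul homology in a given coefficient degree *)

Section Vanishing.
Variables (K : fieldType) (N : nat).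
Local Notation S := {mpoly K[N]}.
Local Notation E := {ffun {set 'I_N} -> S}.
Implicit Types (A B V : {set 'I_N}) (k l : 'I_N) (p q : S) (v w z u : E).

Lemma coeffs_subE v w A : (v - w) A = v A - w A.
Proof. by rewrite !ffunE. Qed.

Lemma coeffs_inj v w : (forall A m, (v A)@_m = (w A)@_m) -> v = w.
Proof. by move=> eq; apply/ffunP => A; apply/mpolyP. Qed.

Definition coeffs_homog (c : nat) v := forall A m, (v A)@_m != 0 -> mdeg m = c.
Definition coeffs_in (I : S -> Prop) v := forall A, I (v A).
(** Tor_i (K, S / I)_(i + c) = 0 for all i at once: the coefficients of a cycle of
    internal degree i + c in homological degree i have degree c. *)
Definition koszul_vanish (I : S -> Prop) c := forall v,
  coeffs_homog c v -> coeffs_in I (koszul_d v) -> exists w, coeffs_in I (v - koszul_d w).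

Section Ideal.
Variables (I : S -> Prop) (Iid : is_ideal I).

Lemma coeffs_in0 : coeffs_in I 0.
Proof. by move=> A; rewrite ffunE; case: Iid. Qed.

Lemma coeffs_inD v w : coeffs_in I v -> coeffs_in I w -> coeffs_in I (v + w).
Proof. by move=> Iv Iw A; rewrite ffunE; case: Iid => _ ID _; apply: ID. Qed.

Lemma coeffs_inB v w : coeffs_in I v -> coeffs_in I w -> coeffs_in I (v - w).
Proof. by move=> Iv Iw A; rewrite !ffunE; apply: is_idealB. Qed.

Lemma coeffs_in_scale p v : coeffs_in I v -> coeffs_in I (scale_by p v).
Proof. by move=> Iv A; rewrite ffunE; case: Iid => _ _; apply. Qed.

Lemma coeffs_in_contract k v : coeffs_in I v -> coeffs_in I (contract k v).
Proof.
move=> Iv A; rewrite ffunE; case: Iid => I0 _ IM.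
by case: ifP => // _; apply: IM.
Qed.

Lemma coeffs_in_wedge k v : coeffs_in I v -> coeffs_in I (wedge k v).
Proof.
move=> Iv A; rewrite ffunE; case: Iid => I0 _ IM.
by case: ifP => // _; apply: IM.
Qed.

Lemma coeffs_in_koszul_d v : coeffs_in I v -> coeffs_in I (koszul_d v).
Proof.
move=> Iv; rewrite /koszul_d; elim/big_ind: _ => [|v1 v2|k _]; first exact: coeffs_in0.
  exact: coeffs_inD.
by apply: coeffs_in_scale; apply: coeffs_in_contract.
Qed.

End Ideal.

Lemma coeffs_in_restrict (U : pred 'X_{1..N}) Q v :
  coeffs_in (monomial_ideal U) v -> coeffs_in (monomial_ideal U) (restrict Q v).
Proof.
by move=> Uv A m; rewrite coeff_restrict; case: ifP => _; [apply: Uv | rewrite eqxx].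
Qed.

Definition degpart c : E -> E := restrict (fun _ m => mdeg m == c).

Lemma koszul_d_degpart c v : koszul_d (degpart c v) = degpart c.+1 (koszul_d v).
Proof. by apply: koszul_d_restrict => k B m _; rewrite mdegD mdeg1 addn1. Qed.

Lemma degpart_homog c v : coeffs_homog c v -> degpart c v = v.
Proof.
move=> hv; apply: coeffs_inj => A m; rewrite coeff_restrict.
by case: eqVneq => // ne; apply/esym/eqP; apply: contraNT ne => /hv ->.
Qed.

Lemma coeffs_homog_degpart c v : coeffs_homog c (degpart c v).
Proof. by move=> A m; rewrite coeff_restrict; case: ifP => [/eqP //|_]; rewrite eqxx. Qed.

Lemma coeffs_homogB c v w : coeffs_homog c v -> coeffs_homog c w -> coeffs_homog c (v - w).
Proof.
move=> hv hw A m; rewrite !ffunE mcoeffB.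
by case: (eqVneq (v A)@_m 0) => [->|/hv //]; rewrite sub0r oppr_eq0 => /hw.
Qed.

Lemma coeffs_homog_koszul_d c v : coeffs_homog c v -> coeffs_homog c.+1 (koszul_d v).
Proof. by move/degpart_homog <-; rewrite koszul_d_degpart; apply: coeffs_homog_degpart. Qed.

(** The long exact sequence of
    0 -> (S / (I : x)) (-1) -> S / I -> S / (I + (x)) -> 0 at one place. A cycle z
    modulo I is the boundary of some w modulo I + (x), so z - d w is x u modulo I;
    then u is a cycle modulo I : x, and x u is a boundary modulo I. *)
Lemma koszul_vanish_colon (U : pred 'X_{1..N}) k c : upclosed U ->
    koszul_vanish (monomial_ideal (fun m => U (m + U_(k))%MM)) c ->
    koszul_vanish (monomial_ideal (fun m => U m || (0 < m k)%N)) c.+1 ->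
  koszul_vanish (monomial_ideal U) c.+1.
Proof.
move=> up van1 van2 z hz Uz; have Uid := monomial_is_ideal K up.
have [|w0 Uw0] := van2 z hz; first by move=> A m /Uz ->.
pose w := degpart c w0; pose q := z - koszul_d w.
have hw : coeffs_homog c w by apply: coeffs_homog_degpart.
have qU : coeffs_in (monomial_ideal (fun m => U m || (0 < m k)%N)) q.
  have -> : q = degpart c.+1 (z - koszul_d w0).
    by rewrite /q /w koszul_d_degpart -{1}(degpart_homog hz) [RHS]raddfB.
  exact: coeffs_in_restrict.
have hq : coeffs_homog c.+1 q by apply: coeffs_homogB => //; apply: coeffs_homog_koszul_d.
pose q1 : E := restrict (fun _ => U) q.
have q1U : coeffs_in (monomial_ideal U) q1 by move=> A; rewrite ffunE; apply: monomial_mfilter.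
have cq A m : ((q - q1) A)@_m = if U m then 0 else (q A)@_m.
  by rewrite coeffs_subE mcoeffB coeff_restrict; case: ifP; rewrite ?subrr ?subr0.
(* The terms of q outside U are divisible by x. *)
pose u : E := [ffun A : {set 'I_N} => mdivX k ((q - q1) A)].
have Xu : scale_by 'X_k u = q - q1.
  apply: coeffs_inj => A m; rewrite !(ffunE (fun A => 'X_k * _)) coeff_XM_if.
  rewrite ffunE coeff_mdivX; case: ifP => [/mnm_subK -> //|m0].
  rewrite cq; case: ifP => // Um; apply/esym/eqP; apply/negPn/negP => /qU.
  by rewrite Um m0.
have hu : coeffs_homog c u.
  move=> A m; rewrite ffunE coeff_mdivX cq; case: ifP => [|_ /hq].
    by rewrite eqxx.
  by rewrite mdegD mdeg1 addn1 => -[].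
have Uu : coeffs_in (monomial_ideal (fun m => U (m + U_(k))%MM)) (koszul_d u).
  move=> A m nz; have : coeffs_in (monomial_ideal U) (scale_by 'X_k (koszul_d u)).
    rewrite -koszul_d_scale Xu raddfB /=; apply: coeffs_inB => //;
      last exact: coeffs_in_koszul_d.
    by rewrite /q raddfB /= koszul_d_koszul_d subr0.
  by move/(_ A (m + U_(k))%MM); rewrite ffunE coeff_XM; apply.
have [w' Uw'] := van1 u hu Uu.
exists (w + scale_by 'X_k w').
have -> : z - koszul_d (w + scale_by 'X_k w') = q1 + scale_by 'X_k (u - koszul_d w').
  rewrite raddfD /= koszul_d_scale [scale_by 'X_k (u - _)]raddfB /= Xu /q.
  by rewrite [RHS]addrA [q1 + _]addrC subrK opprD addrA.
apply: coeffs_inD => // A m; rewrite ffunE coeff_XM_if; case: ifP => [gt0 /Uw'|_].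
  by rewrite mnm_subK.
by rewrite eqxx.
Qed.

Lemma mdivX_XM k p : mdivX k ('X_k * p) = p.
Proof. by apply/mpolyP => m; rewrite coeff_mdivX coeff_XM. Qed.

Lemma mdivX_XM_neq k l p : l != k -> mdivX k ('X_l * p) = 'X_l * mdivX k p.
Proof.
move=> lk; apply/mpolyP => m; rewrite coeff_mdivX !coeff_XM_if mnmDE mnm1E.
rewrite eq_sym (negPf lk) addn0 coeff_mdivX.
case: ifP => // gt0; congr (_@__); apply/mnmP => i.
by rewrite !(mnmDE, mnmBE, mnm1E) addnBAC //; case: eqP => // <-.
Qed.

Definition div_coeffs k v : E := [ffun A : {set 'I_N} => mdivX k (v A)].

Lemma mdivX_is_additive k : zmod_morphism (@mdivX K N k).
Proof. by move=> p q; apply/mpolyP => m; rewrite mcoeffB !coeff_mdivX mcoeffB. Qed.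
HB.instance Definition _ k :=
  GRing.isZmodMorphism.Build S S (@mdivX K N k) (mdivX_is_additive k).

Lemma mdivX_koszul_sign k l A p :
  mdivX k (koszul_sign K l A * p) = koszul_sign K l A * mdivX k p.
Proof. by rewrite /koszul_sign -signr_odd; case: odd; rewrite ?mulN1r ?raddfN ?mul1r. Qed.

Lemma div_coeffs_koszul_d k v :
  div_coeffs k (koszul_d v) = koszul_d (div_coeffs k v) + contract k (v - scale_by 'X_k (div_coeffs k v)).
Proof.
apply/ffunP => A; rewrite ffunE [RHS]ffunE !koszul_dE raddf_sum /=.
rewrite [contract _ _ _]ffunE; case: ifP => kA.
  rewrite addr0; apply: eq_bigr => l lA; rewrite mdivX_XM_neq ?ffunE ?mdivX_koszul_sign //.
  by apply: contraNneq lA => ->.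
rewrite (bigD1 k) ?kA //= [in RHS](bigD1 k) ?kA //= mdivX_XM !ffunE.
rewrite addrAC mulrBr [koszul_sign _ _ _ * ('X_k * _)]mulrCA addrCA subrr addr0.
congr (_ + _); apply: eq_bigr => l /andP[_ lk].
by rewrite mdivX_XM_neq ?ffunE ?mdivX_koszul_sign.
Qed.

Lemma wedge_contractE k v A : wedge k (contract k v) A = if k \in A then v A else 0.
Proof.
rewrite !ffunE; case: ifP => // kA; rewrite !inE eqxx /= setD1K //.
by rewrite koszul_signD1 mulrA koszul_sign_sqr mul1r.
Qed.

(** Division by 'X_k followed by the wedge with k contracts the complex onto its part
    of multidegree zero in the k-th variable. *)
Lemma koszul_homotopy k v :
  koszul_d (wedge k (div_coeffs k v)) + wedge k (div_coeffs k (koszul_d v)) =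
  v - restrict (fun A m => (k \notin A) && (m k == 0%N)) v.
Proof.
rewrite koszul_d_wedge div_coeffs_koszul_d [wedge k (_ + _)]raddfD /= addrA addrNK.
apply/ffunP => A; rewrite [LHS]ffunE wedge_contractE !ffunE.
apply/mpolyP => m; rewrite mcoeffB coeff_mfilter mcoeffD.
case: (boolP (k \in A)) => kA /=.
  by rewrite mcoeffB subr0 addrC subrK.
rewrite mcoeff0 addr0 coeff_XM_if coeff_mdivX.
by case: posnP => [_|gt0]; rewrite ?subrr // mnm_subK // subr0.
Qed.

Definition var_mono V : pred 'X_{1..N} := fun m => [exists k in V, (0 < m k)%N].

Lemma var_mono_upclosed V : upclosed (var_mono V).
Proof.
move=> m m' /existsP[k /andP[kV gt0]]; apply/existsP; exists k.
by rewrite kV mnmDE ltn_addr.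
Qed.

Lemma coeffs_in_div V k v : k \notin V ->
  coeffs_in (monomial_ideal (var_mono V)) v ->
    coeffs_in (monomial_ideal (var_mono V)) (div_coeffs k v).
Proof.
move=> kV Vv A m; rewrite ffunE coeff_mdivX => /Vv /existsP[l /andP[lV]].
rewrite mnmDE mnm1E; case: eqP kV => [->|_ _]; first by rewrite lV.
by rewrite addn0 => gt0; apply/existsP; exists l; rewrite lV.
Qed.

(** Apply [koszul_homotopy] to each variable outside V in turn. This gives the
    exactness of the Koszul complex for V empty, and the homology of S / (V) in
    general. *)
Lemma koszul_cycle V v : coeffs_in (monomial_ideal (var_mono V)) (koszul_d v) ->
  exists w, coeffs_in (monomial_ideal (var_mono V)) (v - koszul_d w -
    restrict (fun A m => all (fun k => (k \notin A) && (m k == 0%N)) (enum (~: V))) v).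
Proof.
have Iid := monomial_is_ideal K (@var_mono_upclosed V).
have : all (fun k => k \notin V) (enum (~: V)).
  by apply/allP => k; rewrite mem_enum inE.
elim: (enum _) v => [v _ Vv|k s IHs v /= /andP[kV sV] Vv].
  exists 0; rewrite raddf0 subr0; rewrite (_ : restrict _ v = v) /=.
    by rewrite subrr; apply: coeffs_in0.
  by apply: coeffs_inj => A m; rewrite coeff_restrict.
pose v1 := restrict (fun A m => (k \notin A) && (m k == 0%N)) v.
have Dv : v = v1 + (koszul_d (wedge k (div_coeffs k v)) + wedge k (div_coeffs k (koszul_d v))).
  by rewrite koszul_homotopy addrC subrK.
have Vh : coeffs_in (monomial_ideal (var_mono V)) (wedge k (div_coeffs k (koszul_d v))).
  by apply: coeffs_in_wedge => //; apply: coeffs_in_div.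
have Vv1 : coeffs_in (monomial_ideal (var_mono V)) (koszul_d v1).
  have -> : koszul_d v1 = koszul_d v - koszul_d (wedge k (div_coeffs k (koszul_d v))).
    by rewrite {1}Dv raddfD /= [koszul_d (_ + wedge _ _)]raddfD /= koszul_d_koszul_d add0r addrK.
  by apply: coeffs_inB => //; apply: coeffs_in_koszul_d.
have [w Vw] := IHs v1 sV Vv1.
exists (w + wedge k (div_coeffs k v)); rewrite [in X in X - _ - _]Dv raddfD /=.
rewrite (_ : restrict _ v = restrict (fun A m => all (fun k => (k \notin A) && (m k == 0%N)) s) v1).
  set P1 := restrict _ v1 in Vw *; set x := koszul_d (wedge _ _); set y := wedge k _.
  have -> : v1 + (x + y) - (koszul_d w + x) - P1 = v1 - koszul_d w - P1 + y.
    by rewrite opprD [x + y]addrC !addrA; do ?rewrite [in LHS](addrAC _ _ (- x)) addrK;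
       rewrite -!addrA; congr (_ + _); rewrite addrC -!addrA.
  exact: coeffs_inD.
apply: coeffs_inj => A m; rewrite !coeff_restrict.
by case: (k \notin A); case: (m k == 0%N); rewrite /= ?if_same.
Qed.

Lemma koszul_vanish_vars V c : (0 < c)%N -> koszul_vanish (monomial_ideal (var_mono V)) c.
Proof.
move=> c_gt0 v hv Vv; have [w Vw] := koszul_cycle Vv; exists w.
rewrite -[v - _](subrK (restrict (fun A m =>
  all (fun k => (k \notin A) && (m k == 0%N)) (enum (~: V))) v)).
apply: (coeffs_inD (monomial_is_ideal K (@var_mono_upclosed V))) => // A m.
rewrite coeff_restrict; case: ifP => [/allP all0 /hv degm|]; last by rewrite eqxx.
have : m != 0%MM by rewrite -mdeg_eq0 degm -lt0n.
apply: contraNT => /existsPn noV; apply/eqP/mnmP => k; rewrite mnm0E.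
have := noV k; case: (boolP (k \in V)) => [_|kV _]; first by rewrite lt0n negbK => /eqP.
by have := all0 k; rewrite mem_enum inE kV => /(_ isT)/andP[_ /eqP].
Qed.

End Vanishing.

(** * The Koszul resolution of the residue field and Tor *)

Section Resolution.
Variables (K : fieldType) (N : nat).
Local Notation S := {mpoly K[N]}.
Local Notation E := {ffun {set 'I_N} -> S}.
Implicit Types (A B : {set 'I_N}).

Definition degree_sets (i : nat) : {set {set 'I_N}} := [set A : {set 'I_N} | #|A| == i].

(** Passage between row vectors on the sets of size i and elements of the whole
    complex supported on these sets. *)
Definition lift_row i (v : 'rV[S]_#|degree_sets i|) : E :=
  [ffun A : {set 'I_N} => \sum_(b | enum_val b == A) v 0 b].
Definition unlift_row i (u : E) : 'rV[S]_#|degree_sets i| := \row_b u (enum_val b).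

Lemma card_enum_degree_sets i (b : 'I_#|degree_sets i|) : #|enum_val b| = i.
Proof. by have := enum_valP b; rewrite inE => /eqP. Qed.

Lemma lift_row_val i v (b : 'I_#|degree_sets i|) : lift_row v (enum_val b) = v 0 b.
Proof. by rewrite ffunE (big_pred1 b) // => b'; rewrite (inj_eq enum_val_inj). Qed.

Lemma lift_row_out i (v : 'rV_#|degree_sets i|) A : #|A| != i -> lift_row v A = 0.
Proof.
move=> neq; rewrite ffunE big1 // => b /eqP eqA.
by rewrite -eqA card_enum_degree_sets eqxx in neq.
Qed.

Lemma degree_sets_enum i A : #|A| = i -> exists b : 'I_#|degree_sets i|, A = enum_val b.
Proof.
move=> cA; have inA : A \in degree_sets i by rewrite inE cA.
by exists (enum_rank_in inA A); rewrite enum_rankK_in.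
Qed.

Lemma lift_unlift i u A : lift_row (unlift_row i u) A = if #|A| == i then u A else 0.
Proof.
case: eqP => [/degree_sets_enum[b ->]|/eqP/lift_row_out //].
by rewrite lift_row_val mxE.
Qed.

Lemma unlift_lift i (v : 'rV_#|degree_sets i|) : unlift_row i (lift_row v) = v.
Proof. by apply/rowP => b; rewrite mxE lift_row_val. Qed.

Definition ext_basis A : E := [ffun B : {set 'I_N} => (B == A)%:R].
Definition koszul_matrix i : 'M[S]_(#|degree_sets i.+1|, #|degree_sets i|) :=
  \matrix_(a, b) koszul_d (ext_basis (enum_val a)) (enum_val b).

Lemma lift_row_sum i (v : 'rV_#|degree_sets i|) :
  lift_row v = \sum_a scale_by (v 0 a) (ext_basis (enum_val a)).
Proof.
apply/ffunP => A; rewrite sum_ffunE ffunE big_mkcond; apply: eq_bigr => a _.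
by rewrite !ffunE eq_sym; case: eqP; rewrite ?mulr1 ?mulr0.
Qed.

Lemma koszul_d_out i (w : 'rV_#|degree_sets i.+1|) A : #|A| != i -> koszul_d (lift_row w) A = 0.
Proof.
move=> neq; rewrite koszul_dE big1 // => k kA; rewrite lift_row_out ?mulr0 //.
by rewrite cardsU1 kA add1n eqSS.
Qed.

Lemma koszul_d_lift i (v : 'rV_#|degree_sets i.+1|) :
  lift_row (v *m koszul_matrix i) = koszul_d (lift_row v).
Proof.
apply/ffunP => A; have [/degree_sets_enum[b ->]|/eqP neq] := (#|A| =P i); last first.
  by rewrite koszul_d_out // lift_row_out.
rewrite lift_row_val lift_row_sum raddf_sum sum_ffunE mxE; apply: eq_bigr => a _.
by rewrite mxE /= koszul_d_scale [RHS]ffunE.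
Qed.

Lemma koszul_d_unlift i (u : E) A : #|A| = i ->
  koszul_d (lift_row (unlift_row i.+1 u)) A = koszul_d u A.
Proof.
move=> cA; rewrite !koszul_dE; apply: eq_bigr => k kA.
by rewrite lift_unlift cardsU1 kA add1n cA eqxx.
Qed.

Definition koszul_complex : graded_free_seq K N :=
  @GradedFreeSeq K N (fun i => #|degree_sets i|) (fun i _ => i) koszul_matrix (const_mx 1).

Lemma var_mono_set0 (p : S) : monomial_ideal (@var_mono N set0) p -> p = 0.
Proof.
move=> U0; apply/mpolyP => m; rewrite mcoeff0; apply/eqP/negPn/negP => /U0.
by case/existsP => k; rewrite inE.
Qed.

(** [koszul_cycle] for the empty set of variables leaves only the constant term on
    the basis element of degree zero. *)
Lemma koszul_exact (v : E) : koszul_d v = 0 ->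
  exists w, v - koszul_d w = [ffun A : {set 'I_N} => if A == set0 then ((v A)@_0%MM)%:MP else 0].
Proof.
move=> v0; have [|w Vw] := @koszul_cycle K N set0 v.
  by rewrite v0; apply: coeffs_in0; apply/monomial_is_ideal/var_mono_upclosed.
exists w; apply: coeffs_inj => A m.
have /mpolyP/(_ m) := var_mono_set0 (Vw A).
rewrite coeffs_subE mcoeffB mcoeff0 => /eqP; rewrite subr_eq0 => /eqP ->.
rewrite coeff_restrict ffunE; case: eqP => [->|/eqP/set0Pn[k kA]]; last first.
  rewrite mcoeff0; case: ifP => // /allP/(_ k).
  by rewrite mem_enum !inE kA => /(_ isT).
rewrite mcoeffC; case: eqP => [->|neq].
  by rewrite mulr1; case: ifP => // /negP[]; apply/allP => k _; rewrite inE mnm0E.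
rewrite mulr0; case: ifP => // /allP all0; case: neq; apply/mnmP => k.
by have := all0 k; rewrite mem_enum !inE mnm0E => /(_ isT) /eqP.
Qed.

Lemma irrelevant_coef0 (p : S) : irrelevant_ideal p -> p@_0%MM = 0.
Proof.
case=> k [c [a [aX ->]]]; rewrite raddf_sum big1 //= => t _.
by have [i ->] := aX t; rewrite mulrC coeff_XM_eq0 // mnm0E.
Qed.

Lemma coeffs_homog_dhomog c (v : E) A : coeffs_homog c v -> v A \is c.-homog.
Proof. by move=> hv; apply/dhomogP => m; rewrite mcoeff_msupp => /hv. Qed.

Lemma ext_basis_homog A : coeffs_homog 0 (ext_basis A).
Proof.
move=> B m; rewrite ffunE; case: (B == A); last by rewrite mcoeff0 eqxx.
by rewrite mcoeff1; case: (eqVneq m 0%MM) => [->|_]; rewrite ?mdeg0 ?eqxx.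
Qed.

Lemma contract_ext_basis k : contract k (ext_basis set0) = 0.
Proof.
apply/ffunP => A; rewrite !ffunE; case: ifP => // _.
by case: eqP => [/setP/(_ k)|]; rewrite ?mulr0 // !inE eqxx.
Qed.

Lemma koszul_d_ext_basis : koszul_d (ext_basis set0) = 0.
Proof. by rewrite /koszul_d big1 // => k _; rewrite contract_ext_basis raddf0. Qed.

Lemma lift_gaug (v : 'rV_#|degree_sets 0|) : (v *m gaug koszul_complex) 0 0 = lift_row v set0.
Proof.
rewrite mxE ffunE; apply: eq_big => [b|b _]; last by rewrite mxE mulr1.
by apply/esym/eqP/cards0_eq; rewrite card_enum_degree_sets.
Qed.

Lemma koszul_resolution : graded_free_resolution koszul_complex (@irrelevant_ideal K N).
Proof.
have [I0 ID IM] := ideal_gen_is_ideal (fun p : S => exists i : 'I_N, p = 'X_i).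
split.
- move=> i k b; rewrite /homog_shift /= leqnSn subSnn !mxE.
  by apply: coeffs_homog_dhomog; apply: coeffs_homog_koszul_d; apply: ext_basis_homog.
- by move=> k; rewrite mxE dhomog1.
- exists (unlift_row 0 (ext_basis set0)); rewrite lift_gaug lift_unlift cards0 eqxx.
  by rewrite ffunE eqxx subrr.
- move=> v; rewrite lift_gaug; split=> [Iv|[w ->]].
    have [|w eqw] := @koszul_exact (lift_row v).
      by apply/ffunP => A; rewrite ffunE koszul_dE big1 // => k kA;
        rewrite lift_row_out ?mulr0 // cardsU1 kA.
    exists (unlift_row 1 w); apply: (can_inj (@unlift_lift 0)).
    rewrite koszul_d_lift; apply/ffunP => A.
    case: (eqVneq #|A| 0%N) => [A0|neq]; last by rewrite koszul_d_out // lift_row_out.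
    rewrite koszul_d_unlift //; apply/eqP; rewrite -subr_eq0 -coeffs_subE eqw ffunE.
    by move/cards0_eq: A0 ->; rewrite eqxx irrelevant_coef0.
  rewrite koszul_d_lift koszul_dE; apply: is_ideal_sum => // k _.
  by rewrite mulrC; apply: IM; apply: ideal_gen_mem; exists k.
- move=> i v; split=> [v0|[w ->]]; last first.
    by apply: (can_inj (@unlift_lift i)); rewrite !koszul_d_lift koszul_d_koszul_d;
      apply/ffunP => A;
      rewrite !ffunE big1 // => b _; rewrite mxE.
  have [|w eqw] := @koszul_exact (lift_row v).
    by rewrite -koszul_d_lift v0; apply/ffunP => A; rewrite !ffunE big1 // => b _; rewrite mxE.
  exists (unlift_row i.+2 w); apply: (can_inj (@unlift_lift i.+1)).
  rewrite koszul_d_lift; apply/ffunP => A.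
  case: (eqVneq #|A| i.+1) => [Ai|neq]; last by rewrite koszul_d_out // lift_row_out.
  rewrite koszul_d_unlift //; apply/eqP; rewrite -subr_eq0 -coeffs_subE eqw ffunE.
  by case: (eqVneq A set0) Ai => [->|//]; rewrite cards0.
Qed.

Section Tor.
Variables (I : S -> Prop) (Iid : is_ideal I).

Lemma koszul_d_lift_row0 (v : 'rV_#|degree_sets 0|) : koszul_d (lift_row v) = 0.
Proof.
apply/ffunP => A; rewrite ffunE koszul_dE big1 // => k kA.
by rewrite lift_row_out ?mulr0 // cardsU1 kA.
Qed.

Lemma tor_neq0_koszul_vanish i j : tor_neq0 koszul_complex I i j ->
  (i <= j)%N /\ ~ koszul_vanish I (j - i).
Proof.
case=> v [hv cyc nbd]; case: (leqP i j) => [le|lt]; last first.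
  case: nbd; exists 0 => b; rewrite mul0mx subr0.
  by have := hv b; rewrite /homog_shift /= leqNgt lt => /eqP ->; case: Iid.
split=> // van; apply: nbd.
have [||w Iw] := van (lift_row v).
- move=> A m; case: (eqVneq #|A| i) => [/degree_sets_enum[b ->]|/lift_row_out ->]; last first.
    by rewrite mcoeff0 eqxx.
  have := hv b; rewrite /homog_shift /= le lift_row_val => /dhomogP hb.
  by rewrite -mcoeff_msupp => /hb.
- case: i v {hv le van} cyc => [|i] v /= cyc A; first by rewrite koszul_d_lift_row0 ffunE;
  case: Iid.
  rewrite -koszul_d_lift; case: (eqVneq #|A| i) => [/degree_sets_enum[b ->]|/lift_row_out ->].
    by rewrite lift_row_val; apply: cyc.
  by case: Iid.
exists (unlift_row i.+1 w) => b; have := Iw (enum_val b).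
rewrite coeffs_subE lift_row_val -(koszul_d_unlift _ (card_enum_degree_sets b)) -koszul_d_lift lift_row_val.
by rewrite !mxE.
Qed.

(** If Tor vanished in internal degree i + c for each homological degree i, the
    boundaries found for the components of a cycle would add up to a boundary for
    the cycle. *)
Lemma not_koszul_vanish_tor c : ~ koszul_vanish I c ->
  exists i, tor_neq0 koszul_complex I i (i + c).
Proof.
move=> nvan; apply: NNPP => notor; apply: nvan => v hv Iv.
have bd (i : 'I_N.+1) : exists w : 'rV[S]_#|degree_sets i.+1|,
    mod_ideal I (unlift_row i v - w *m koszul_matrix i).
  apply: NNPP => nbd; apply: notor; exists i, (unlift_row i v); split.
  - move=> b; rewrite /homog_shift /= leq_addr addKn mxE.
    exact: coeffs_homog_dhomog.
  - case: (nat_of_ord i) => //= {nbd}i b.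
    by rewrite -lift_row_val koszul_d_lift koszul_d_unlift ?card_enum_degree_sets.
  - by case=> w bw; apply: nbd; exists w.
have [f fP] := fin_all_exists bd.
exists (\sum_i lift_row (f i)) => A.
have [i0 ci0] : exists i0 : 'I_N.+1, #|A| = i0.
  have ltA : (#|A| < N.+1)%N by rewrite ltnS -[X in (_ <= X)%N](card_ord N) max_card.
  by exists (Ordinal ltA).
rewrite coeffs_subE raddf_sum sum_ffunE (bigD1 i0) //= big1 ?addr0; last first.
  by move=> i neq; apply: koszul_d_out; rewrite ci0 eq_sym.
have [b ->] := degree_sets_enum ci0; rewrite -koszul_d_lift lift_row_val.
by have := fP i0 b; rewrite !mxE.
Qed.

Lemma not_koszul_vanish0 : (forall p, I p -> p@_0%MM = 0) -> ~ koszul_vanish I 0.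
Proof.
move=> I0 van; have [||w Iw] := van (ext_basis set0); first exact: ext_basis_homog.
  by rewrite koszul_d_ext_basis; apply: coeffs_in0.
have := I0 _ (Iw set0); rewrite coeffs_subE ffunE eqxx mcoeffB mcoeff1 eqxx koszul_dE raddf_sum.
rewrite big1 => [/eqP|k _ /=]; first by rewrite subr0 oner_eq0.
by rewrite coeff_XM_eq0 // mnm0E.
Qed.

Lemma is_reg_of_koszul_vanish l : (forall c, (l < c)%N -> koszul_vanish I c) ->
  ~ koszul_vanish I l ->
  is_reg I (Posz l).
Proof.
move=> van nvan; exists koszul_complex; split; first exact: koszul_resolution.
  have [i tor] := not_koszul_vanish_tor nvan; exists i, (i + l)%N; split=> //.
  by rewrite PoszD addrC addKr.
move=> i j /tor_neq0_koszul_vanish[le nv]; rewrite subzn // lez_nat leqNgt.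
by apply/negP => /van.
Qed.

End Tor.
End Resolution.

(** * Passing from an initial ideal to the ideal *)

Section Semicontinuity.
Variables (K : fieldType) (N : nat).
Local Notation S := {mpoly K[N]}.
Local Notation E := {ffun {set 'I_N} -> S}.
Implicit Types (A B : {set 'I_N}) (z w : E).

Variables (weight : 'I_N -> nat).

Definition mon_weight (m : 'X_{1..N}) : nat := \sum_k weight k * m k.
Definition multi_weight A m : nat := mon_weight m + \sum_(k in A) weight k.

Lemma mon_weightD m m' : mon_weight (m + m')%MM = (mon_weight m + mon_weight m')%N.
Proof. by rewrite -big_split; apply: eq_bigr => k _; rewrite mnmDE mulnDr. Qed.

Lemma mon_weightU k : mon_weight U_(k)%MM = weight k.
Proof.
rewrite /mon_weight (bigD1 k) //= mnm1E eqxx muln1 big1 ?addn0 // => l neq.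
by rewrite mnm1E eq_sym (negPf neq) muln0.
Qed.

Lemma multi_weight_move k B m : k \notin B ->
  multi_weight (k |: B) m = multi_weight B (m + U_(k))%MM.
Proof. by move=> kB; rewrite /multi_weight big_setU1 //= mon_weightD mon_weightU addnA. Qed.

(** Semicontinuity along a weight filtration. The part of top weight of a cycle
    modulo J is a cycle modulo the monomial ideal of U, hence a boundary up to
    coefficients in that ideal. Replacing each monomial m in these coefficients by
    r m changes them by elements of J and lowers the weight; the induction is on a
    strict bound b for the weights. *)
Lemma koszul_vanish_initial (U : pred 'X_{1..N}) (J : S -> Prop) (r : 'X_{1..N} -> 'X_{1..N}) c :
    upclosed U -> is_ideal J ->
    (forall f m, J f -> f@_m != 0 -> ~~ U m -> exists2 m', f@_m' != 0 & (mon_weight m < mon_weight m')%N) ->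
    (forall m, U m -> [/\ J ('X_[m] - 'X_[r m]), (mon_weight (r m) < mon_weight m)%N & mdeg (r m) = mdeg m]) ->
  koszul_vanish (@monomial_ideal K N U) c.+1 -> koszul_vanish J c.+1.
Proof.
move=> up Jid topU lowerU vanU.
suff vanJ b z : coeffs_homog c.+1 z -> coeffs_in J (koszul_d z) ->
    (forall A m, (z A)@_m != 0 -> (multi_weight A m < b)%N) ->
      exists w, coeffs_in J (z - koszul_d w).
  move=> z hz Jz; pose b A := (\max_(m <- msupp (z A)) (multi_weight A m).+1)%N.
  apply: (vanJ (\max_A b A)%N) => // A m nz; apply: leq_trans (leq_bigmax A).
  by rewrite /b (bigD1_seq m) ?msupp_uniq ?mcoeff_msupp //= leq_maxl.
elim: b z => [|b IHb] z hz Jz ltb.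
  exists 0; rewrite raddf0 subr0 (_ : z = 0); first exact: coeffs_in0.
  apply: coeffs_inj => A m; rewrite ffunE mcoeff0; apply/eqP/negPn/negP.
  by move/ltb; rewrite ltn0.
pose z0 : E := restrict (fun A m => multi_weight A m == b) z.
have kdz_le A m : (koszul_d z A)@_m != 0 -> (multi_weight A m <= b)%N.
  rewrite (_ : z = restrict (fun A m => multi_weight A m <= b)%N z).
    rewrite (koszul_d_restrict (Q' := fun A m => multi_weight A m <= b)%N) => [|k B m' kB].
      by rewrite coeff_restrict; case: ifP => //; rewrite eqxx.
    by rewrite multi_weight_move.
  apply: coeffs_inj => A' m'; rewrite coeff_restrict; case: ifP => // /negbT.
  case: (eqVneq (z A')@_m' 0) => // /ltb; by rewrite ltnS => ->.
have Uz0 : coeffs_in (monomial_ideal U) (koszul_d z0).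
  rewrite /z0 (koszul_d_restrict (Q' := fun A m => multi_weight A m == b)) => [|k B m' kB].
    move=> A m; rewrite coeff_restrict; case: ifP => [/eqP eqb nz|]; last by rewrite eqxx.
    apply/negPn/negP => nU; have [m' nz' lt] := topU _ _ (Jz A) nz nU.
    by have := kdz_le _ _ nz'; rewrite -eqb /multi_weight leq_add2r leqNgt lt.
  by rewrite multi_weight_move.
have hz0 : coeffs_homog c.+1 z0.
  by move=> A m; rewrite coeff_restrict; case: ifP => [_ /hz //|]; rewrite eqxx.
have [w0 Uw0] := vanU z0 hz0 Uz0.
(* Only the part of w0 of the right weight and degree contributes to z0. *)
pose w1 : E := restrict (fun A m => (multi_weight A m == b) && (mdeg m == c)) w0.
pose q : E := z0 - koszul_d w1.
pose Q A m := (multi_weight A m == b) && (mdeg m == c.+1).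
have qP : q = restrict Q (z0 - koszul_d w0).
  rewrite /q /w1 (koszul_d_restrict (Q' := Q)) => [|k B m kB].
    rewrite [RHS]raddfB; congr (_ - _); apply: coeffs_inj => A m; rewrite !coeff_restrict /Q.
    case: (multi_weight A m == b) => //=; case: eqP => // neq.
    by apply/eqP/negPn/negP => /hz.
  by rewrite /Q multi_weight_move // mdegD mdeg1 addn1 eqSS.
have qU : coeffs_in (monomial_ideal U) q by rewrite qP; apply: coeffs_in_restrict.
have qQ A m : (q A)@_m != 0 -> multi_weight A m = b /\ mdeg m = c.+1.
  by rewrite qP coeff_restrict; case: ifP => [/andP[/eqP-> /eqP->]|]; rewrite ?eqxx.
pose q' : E := [ffun A : {set 'I_N} =>
  \sum_(m <- msupp (q A)) (q A)@_m *: ('X_[m] - 'X_[r m])].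
have q'J : coeffs_in J q'.
  move=> A; rewrite ffunE big_seq; apply: is_ideal_sum => // m.
  rewrite mcoeff_msupp => /qU /lowerU[Jm _ _]; rewrite -mul_mpolyC.
  by case: Jid => _ _; apply.
have qq' A m : ((q - q') A)@_m != 0 ->
    exists m', [/\ m = r m', (q A)@_m' != 0 & U m'].
  rewrite coeffs_subE [q' A]ffunE [q A in X in X - _]mpolyE -sumrB raddf_sum /=.
  move=> nz; case: (boolP (has (fun m' => m == r m') (msupp (q A)))) => [|/hasPn no].
    case/hasP => m'; rewrite mcoeff_msupp => nz' /eqP ->; exists m'; split=> //.
    exact: qU nz'.
  case/negP: nz; rewrite big_seq big1 // => m' /no neq.
  by rewrite -scalerBr opprB addrC subrK mcoeffZ mcoeffX eq_sym (negPf neq) mulr0.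
pose z1 := z - koszul_d w1 - q'.
have Dz1 : z1 = (z - z0) + (q - q').
  by rewrite /z1 /q !addrA subrK.
have nz1 A m : (z1 A)@_m != 0 -> ((z - z0) A)@_m != 0 \/ ((q - q') A)@_m != 0.
  rewrite Dz1 ffunE mcoeffD; case: (eqVneq (_@__) 0) => [->|_]; last by left.
  by rewrite add0r; right.
have zz0 A m : ((z - z0) A)@_m = if multi_weight A m == b then 0 else (z A)@_m.
  by rewrite coeffs_subE mcoeffB coeff_restrict; case: ifP; rewrite ?subrr ?subr0.
have [|||w2 Jw2] := IHb z1.
- move=> A m /nz1[]; first by rewrite zz0; case: ifP => [|_ /hz //]; rewrite eqxx.
  by case/qq' => m' [-> /qQ[_ dm'] /lowerU[_ _ ->]].
- rewrite /z1 !raddfB /= koszul_d_koszul_d subr0; apply: coeffs_inB => //;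
  exact: coeffs_in_koszul_d.
- move=> A m /nz1[]; rewrite ?zz0.
    by case: ifP => [_|neq /ltb]; rewrite ?eqxx // ltnS leq_eqVlt neq.
  by case/qq' => m' [-> /qQ[<- _] /lowerU[_ lt _]]; rewrite /multi_weight ltn_add2r.
exists (w1 + w2); rewrite raddfD /= (_ : z - _ = z1 - koszul_d w2 + q').
  exact: coeffs_inD.
by rewrite /z1 opprD addrA [RHS]addrAC subrK.
Qed.

End Semicontinuity.

(** * The Groebner basis of a closed graph *)

Section LexOrder.
Variable N : nat.
Implicit Types m : 'X_{1..N}.

Lemma lexlt_irr m : ~~ lexlt m m.
Proof. by apply/existsPn => i; rewrite ltnn. Qed.

Lemma lexlt_trans m2 m1 m3 : lexlt m1 m2 -> lexlt m2 m3 -> lexlt m1 m3.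
Proof.
case/existsP => i /andP[lti /forallP eqi] /existsP[j /andP[ltj /forallP eqj]].
have eqi' (k : 'I_N) : (k < i)%N -> m1 k = m2 k by move=> lt; have := eqi k; rewrite lt => /eqP.
have eqj' (k : 'I_N) : (k < j)%N -> m2 k = m3 k by move=> lt; have := eqj k; rewrite lt => /eqP.
apply/existsP; case: (ltngtP i j) => [ij|ji|/val_inj eq_ij].
- exists i; rewrite -(eqj' _ ij) lti; apply/forallP => k; apply/implyP => ki.
  by rewrite eqi' // eqj' // (ltn_trans ki).
- exists j; rewrite (eqi' _ ji) ltj; apply/forallP => k; apply/implyP => kj.
  by rewrite eqi' ?eqj' // (ltn_trans kj).
- subst j; exists i; rewrite (ltn_trans lti ltj); apply/forallP => k; apply/implyP => ki.
  by rewrite eqi' ?eqj'.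
Qed.

End LexOrder.

Section Rewriting.
Variables (n : nat) (e : rel 'I_n).
Hypotheses (e_sym : symmetric e) (e_closed : closed_labeling e).
Local Notation mon := 'X_{1..(n + n)%N}.
Local Notation X i := (lshift n i).
Local Notation Y i := (rshift n i).
Implicit Types (m : mon) (p q : 'I_n * 'I_n).

Definition up_edge (i j : 'I_n) := (i < j)%N && e i j.

Definition redex p m := [&& up_edge p.1 p.2, (0 < m (X p.1))%N & (0 < m (Y p.2))%N].
(** Reduction by one generator of J_G: x_i y_j becomes x_j y_i. *)
Definition sort_step p m : mon :=
  (m - (U_(X p.1) + U_(Y p.2)) + (U_(X p.2) + U_(Y p.1)))%MM.
Definition edge_mono m := [exists p, redex p m].

Lemma edge_mono_upclosed : upclosed edge_mono.
Proof.
move=> m m' /existsP[p /and3P[Rp gt1 gt2]]; apply/existsP; exists p.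
by rewrite /redex Rp !mnmDE !ltn_addr.
Qed.

Lemma sort_stepX p m i : sort_step p m (X i) = (m (X i) - (p.1 == i) + (p.2 == i))%N.
Proof.
by rewrite /sort_step mnmDE mnmBE !mnmDE !mnm1E !eq_rlshift !eq_lshift !addn0.
Qed.

Lemma sort_stepY p m i : sort_step p m (Y i) = (m (Y i) - (p.2 == i) + (p.1 == i))%N.
Proof.
by rewrite /sort_step mnmDE mnmBE !mnmDE !mnm1E !eq_lrshift !eq_rshift !add0n.
Qed.

Lemma mon_eqP m m' :
  (forall i, m (X i) = m' (X i)) -> (forall i, m (Y i) = m' (Y i)) -> m = m'.
Proof. by move=> eqX eqY; apply/mnmP => k; case: (split_ordP k) => i ->. Qed.

Lemma redex_decomp p m : redex p m ->
  m = (m - (U_(X p.1) + U_(Y p.2)) + (U_(X p.1) + U_(Y p.2)))%MM.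
Proof.
case/and3P=> _ gtX gtY; rewrite submK //; apply/mnm_lepP => k.
rewrite mnmDE !mnm1E; case: (split_ordP k) => i ->.
  by rewrite eq_lshift eq_rlshift addn0; case: eqP => // <-.
by rewrite eq_rshift eq_lrshift add0n; case: eqP => // <-.
Qed.

Lemma sort_step_add a p : sort_step p (a + (U_(X p.1) + U_(Y p.2)))%MM =
  (a + (U_(X p.2) + U_(Y p.1)))%MM.
Proof. by rewrite /sort_step addmK. Qed.

Lemma mdeg_sort_step p m : redex p m -> mdeg (sort_step p m) = mdeg m.
Proof. by move/redex_decomp => ->; rewrite sort_step_add !mdegD !mdeg1. Qed.

(** Giving y_j the weight j and x_i the weight 0 makes every [sort_step] decrease
    the weight by j - i. *)
Definition y_weight (k : 'I_(n + n)) : nat :=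
  match split k with inl _ => 0%N | inr i => i end.
Local Notation wt := (mon_weight y_weight).

Lemma weight_sort_step p m : redex p m -> (wt (sort_step p m) < wt m)%N.
Proof.
move=> red; rewrite (redex_decomp red) sort_step_add !mon_weightD ltn_add2l !mon_weightU /y_weight.
rewrite -[X p.1]/(unsplit (inl p.1)) -[X p.2]/(unsplit (inl p.2)).
rewrite -[Y p.1]/(unsplit (inr p.1)) -[Y p.2]/(unsplit (inr p.2)) !unsplitK.
by case/and3P: red => /andP[].
Qed.

Lemma lexlt_sort_step p m : redex p m -> lexlt (sort_step p m) m.
Proof.
case/and3P=> /andP[lt _] gtX gtY; apply/existsP; exists (X p.1).
have neq : (p.2 == p.1) = false by apply/eqP => eq; rewrite eq ltnn in lt.
rewrite sort_stepX eqxx neq addn0 subn1 prednK // leqnn /=.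
apply/forallP => k; apply/implyP; case: (split_ordP k) => i -> /= lti.
  rewrite sort_stepX; case: (eqVneq p.1 i) lti => [->|_ lti]; first by rewrite ltnn.
  case: (eqVneq p.2 i) lti => [<-|_ _]; last by rewrite subn0 addn0.
  by move/(ltn_trans lt); rewrite ltnn.
by have := ltn_ord p.1; rewrite ltnNge ltnW // (leq_ltn_trans (leq_addr i n) lti).
Qed.

Definition steps_to m c := m = c \/ exists2 p, redex p m & sort_step p m = c.

(** Local confluence. Disjoint redexes commute. For x_i y_j and x_i y_l with j < l,
    closedness at i gives the edge j l, and x_j y_i y_l reduces along it to
    x_l y_i y_j; the case of a shared y is symmetric. *)
Lemma confluent_fork p q m : redex p m -> redex q m ->
  exists c, steps_to (sort_step p m) c /\ steps_to (sort_step q m) c.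
Proof.
suff half a b : redex a m -> redex b m ->
    [|| a == b, (a.1 == b.1) && (a.2 < b.2)%N, (a.2 == b.2) && (a.1 < b.1)%N |
        (a.1 != b.1) && (a.2 != b.2)] ->
    exists c, steps_to (sort_step a m) c /\ steps_to (sort_step b m) c.
  move=> rp rq; case: (boolP [|| p == q, (p.1 == q.1) && (p.2 < q.2)%N,
    (p.2 == q.2) && (p.1 < q.1)%N | (p.1 != q.1) && (p.2 != q.2)]) => [|N].
    exact: half.
  have [|c [qc pc]] := half q p rq rp; last by exists c.
  case: p q {rp rq} N => i j [k l]; rewrite !xpair_eqE -!val_eqE /=; lia.
case: a => i j; case: b => k l; rewrite /redex /=.
case/and3P=> Rij mXi mYj /and3P[Rkl mXk mYl] /or4P[/eqP[<- <-]|/andP[/eqP eq lt]|/andP[/eqP eq lt]|/andP[ik jl]].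
- by exists (sort_step (i, j) m); split; left.
- subst k; exists (sort_step (i, l) m); split; last by left.
  have [[ltij eij] [ltil eil]] := (andP Rij, andP Rkl).
  have jl : j != l by rewrite neq_ltn lt.
  have ejl : e j l by apply: (e_closed jl eij eil); rewrite ltij ltil.
  right; exists (j, l).
    rewrite /redex /= /up_edge lt ejl sort_stepX sort_stepY /= eqxx addn1 /=.
    by rewrite (negPf jl) subn0 ltn_addr.
  apply: mon_eqP => a; rewrite !(sort_stepX, sort_stepY) /=.
    lia.
  have : (m (Y a) >= (j == a) + (l == a))%N.
    case: (eqVneq j a) => [<-|_]; first by rewrite (eq_sym l) (negPf jl).
    by case: eqVneq => // <-.
  lia.
- subst l; exists (sort_step (i, j) m); split; first by left.
  have [[ltij eij] [ltkj ekj]] := (andP Rij, andP Rkl).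
  have ik : i != k by rewrite neq_ltn lt.
  have eik : e i k.
    by apply: (e_closed (i := j) ik); rewrite 1?e_sym // ltij ltkj orbT.
  right; exists (i, k).
    rewrite /redex /= /up_edge lt eik sort_stepX sort_stepY /= eqxx addn1 /= andbT.
    by rewrite eq_sym (negPf ik) subn0 ltn_addr.
  apply: mon_eqP => a; rewrite !(sort_stepX, sort_stepY) /=.
    have : (m (X a) >= (i == a) + (k == a))%N.
      case: (eqVneq i a) => [<-|_]; first by rewrite (eq_sym k) (negPf ik).
      by case: eqVneq => // <-.
    lia.
  lia.
have gtX a : (m (X a) >= (i == a) + (k == a))%N.
  case: (eqVneq i a) => [<-|_]; first by rewrite (eq_sym k) (negPf ik).
  by case: eqVneq => // <-.
have gtY a : (m (Y a) >= (j == a) + (l == a))%N.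
  case: (eqVneq j a) => [<-|_]; first by rewrite (eq_sym l) (negPf jl).
  by case: eqVneq => // <-.
exists (sort_step (k, l) (sort_step (i, j) m)); split; right.
  exists (k, l) => //; rewrite /redex /= Rkl sort_stepX sort_stepY /= (negPf ik) (negPf jl) !subn0.
  by rewrite !ltn_addr.
exists (i, j).
  rewrite /redex /= Rij sort_stepX sort_stepY /= (eq_sym k i) (eq_sym l j) (negPf ik) (negPf jl) !subn0.
  by rewrite !ltn_addr.
apply: mon_eqP => a; rewrite !(sort_stepX, sort_stepY) /=.
  by have := gtX a; lia.
by have := gtY a; lia.
Qed.

(** The fuel b is a bound for the number of steps; the weight is always enough. *)
Fixpoint normal_form_fuel (b : nat) m :=
  if b is b'.+1 then
    if [pick p | redex p m] is Some p then normal_form_fuel b' (sort_step p m) else m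
  else m.
Definition normal_form m := normal_form_fuel (wt m) m.

Lemma normal_form_fuel_eq b b' m : (wt m <= b)%N -> (wt m <= b')%N ->
  normal_form_fuel b m = normal_form_fuel b' m.
Proof.
have irr0 m' b0 : (wt m' <= 0)%N -> normal_form_fuel b0 m' = m'.
  rewrite leqn0 => /eqP wt0; case: b0 => //= b0.
  by case: pickP => // p /weight_sort_step; rewrite wt0.
elim: b b' m => [|b IHb] [|b'] m le1 le2; try by rewrite !irr0.
rewrite /=; case: pickP => // p /weight_sort_step lt; apply: IHb; rewrite -ltnS;
  exact: leq_trans lt _.
Qed.

Lemma normal_form_unfold m :
  normal_form m = if [pick p | redex p m] is Some p then normal_form (sort_step p m) else m.
Proof.
rewrite {1}/normal_form (@normal_form_fuel_eq _ (wt m).+1) //=;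
  case: pickP => // p /weight_sort_step lt.
by apply: normal_form_fuel_eq => //; apply: ltnW.
Qed.

Lemma normal_form_irr m : ~~ edge_mono m -> normal_form m = m.
Proof.
move=> irr; rewrite normal_form_unfold; case: pickP => // p red.
by case/existsP: irr; exists p.
Qed.

(** Newman's lemma, by induction on the weight. *)
Lemma normal_form_sort_step p m : redex p m -> normal_form (sort_step p m) = normal_form m.
Proof.
have [b] := ubnP (wt m); elim: b m p => // b IHb m p; rewrite ltnS => leb rp.
rewrite [RHS]normal_form_unfold; case: pickP => [q rq|no]; last by rewrite no in rp.
have [c [pc qc]] := confluent_fork rp rq.
have NFc a : redex a m -> steps_to (sort_step a m) c ->
  normal_form (sort_step a m) = normal_form c.
  move=> ra [-> //|[a' ra' <-]]; apply/esym/IHb => //.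
  exact: leq_trans (weight_sort_step ra) leb.
by rewrite (NFc p) // (NFc q).
Qed.

Lemma normal_form_lt (lt : rel mon) :
    transitive lt -> (forall p m, redex p m -> lt (sort_step p m) m) ->
  forall m, edge_mono m -> lt (normal_form m) m.
Proof.
move=> lt_trans lt_rw m; have [b] := ubnP (wt m); elim: b m => // b IHb m leb /existsP[p rp].
rewrite normal_form_unfold; case: pickP => [q rq|no]; last by rewrite no in rp.
case: (boolP (edge_mono (sort_step q m))) => [red|/normal_form_irr ->]; last exact: lt_rw.
apply: (lt_trans (sort_step q m)); last exact: lt_rw.
by apply: IHb => //; apply: leq_trans (weight_sort_step rq) leb.
Qed.

Section Ideal.
Variable K : fieldType.
Local Notation S := {mpoly K[(n + n)%N]}.
Local Notation J := (binomial_edge_ideal K e).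

Lemma edge_ideal_is_ideal : is_ideal J.
Proof. exact: ideal_gen_is_ideal. Qed.

Lemma redex_binomial p m : redex p m -> J ('X_[m] - 'X_[sort_step p m]).
Proof.
move=> rp; rewrite (redex_decomp rp) sort_step_add !mpolyXD -mulrBr.
case: edge_ideal_is_ideal => _ _; apply; apply: ideal_gen_mem; exists p.1, p.2.
by case/and3P: rp => /andP[].
Qed.

(** The linear map sending a monomial to its normal form kills the generators of J_G
    times monomials, hence J_G. *)
Lemma edge_ideal_fiber_sum (f : S) m : J f ->
  \sum_(m' <- msupp f | normal_form m' == m) f@_m' = 0.
Proof.
move=> Jf; pose g m' := (normal_form m' == m)%:R : K.
have -> : \sum_(m' <- msupp f | normal_form m' == m) f@_m' = linext g f.
  rewrite big_mkcond; apply: eq_bigr => m' _ /=; rewrite /g.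
  by case: eqP => _; rewrite ?mulr1 ?mulr0.
case: Jf => k [c [a [aJ ->]]]; rewrite raddf_sum big1 //= => t _.
have [i [j [lt eij ->]]] := aJ t.
rewrite mulrC mulrBl raddfB /= -!mpolyXD !linextXM.
apply/eqP; rewrite subr_eq0; apply/eqP/eq_linext => b; rewrite /g.
pose p := (i, j); congr (_ == _)%:R.
rewrite [(_ + b)%MM in RHS]addmC -(sort_step_add b p) normal_form_sort_step 1?addmC //.
rewrite /redex /up_edge /= lt eij !mnmDE !mnm1E !eqxx.
by apply/andP; split; lia.
Qed.

(** The coefficient of m must cancel in [edge_ideal_fiber_sum] against a monomial with the
    same normal form. *)
Lemma edge_ideal_standard (f : S) m : J f -> f@_m != 0 -> ~~ edge_mono m ->
  exists m', [/\ f@_m' != 0, edge_mono m' & normal_form m' = m].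
Proof.
move=> Jf nz irr.
case: (boolP (has (fun m' => (normal_form m' == m) && (m' != m)) (msupp f))).
  case/hasP => m'; rewrite mcoeff_msupp => nz' /andP[/eqP eqNF neq]; exists m'.
  split=> //; apply: contraNT neq => irr'.
  by rewrite -eqNF (normal_form_irr irr').
move/hasPn => uniq; case/eqP: (nz); rewrite -[RHS](edge_ideal_fiber_sum m Jf).
rewrite big_mkcond (bigD1_seq m) ?msupp_uniq ?mcoeff_msupp //= normal_form_irr // eqxx.
rewrite big_seq_cond big1 ?addr0 // => m' /andP[/uniq + neq].
by rewrite neq andbT => /negPf ->.
Qed.

(** A standard lex-leading monomial of an element of J_G would be the normal form of
    another monomial of that element, which is lex-larger. *)
Lemma in_lex_edge_ideal (f : S) : in_lex J f <-> monomial_ideal edge_mono f.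
Proof.
split.
  apply: ideal_gen_sub; first exact: monomial_is_ideal edge_mono_upclosed.
  move=> _ [g [m [Jg [in_m lead_m] ->]]] m'.
  rewrite mcoeffX; case: (eqVneq m m') => [<- _|_]; last by rewrite eqxx.
  case: (boolP (edge_mono m)) => // irr; rewrite mcoeff_msupp in in_m.
  have [m1 [nz1 red1 NF1]] := edge_ideal_standard Jg in_m irr.
  have lt1 : lexlt m m1.
    rewrite -NF1; apply: normal_form_lt => //; last exact: lexlt_sort_step.
    by move=> x y z; apply: lexlt_trans.
  have neq : m1 != m by apply: contraNneq irr => <-.
  have lt2 : lexlt m1 m by apply: lead_m => //; rewrite mcoeff_msupp.
  by have := lexlt_irr m; rewrite (lexlt_trans lt1 lt2).
move=> Uf; rewrite [f]mpolyE big_seq; apply: is_ideal_sum => [|m].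
  exact: ideal_gen_is_ideal.
rewrite mcoeff_msupp => /Uf/existsP[p rp]; rewrite -mul_mpolyC.
case: (ideal_gen_is_ideal (fun q : S => exists f m, [/\ J f, lex_lead f m & q = 'X_[m]])) => _ _; apply.
apply: ideal_gen_mem; exists ('X_[m] - 'X_[sort_step p m]), m; split=> //.
  exact: redex_binomial.
have lt := lexlt_sort_step rp; have neq : sort_step p m != m.
  by apply: contraTneq lt => ->; apply: lexlt_irr.
split=> [|m']; rewrite mcoeff_msupp mcoeffB !mcoeffX.
  by rewrite eqxx (negPf neq) subr0 oner_eq0.
case: (eqVneq (sort_step p m) m') => [<- //|_] + neq'.
by rewrite (eq_sym m) (negPf neq') subr0 eqxx.
Qed.

Lemma koszul_vanish_edge_ideal c : koszul_vanish (@monomial_ideal K _ edge_mono) c.+1 ->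
  koszul_vanish J c.+1.
Proof.
apply: (@koszul_vanish_initial _ _ y_weight _ _ (fun m => if [pick p | redex p m] is Some p then sort_step p m else m)).
- exact: edge_mono_upclosed.
- exact: edge_ideal_is_ideal.
- move=> f m Jf nz irr; have [m' [nz' red' NF']] := edge_ideal_standard Jf nz irr.
  exists m' => //; rewrite -NF'; apply: (@normal_form_lt (fun a b => wt a < wt b)%N) => //.
    by move=> x y z; apply: ltn_trans.
  exact: weight_sort_step.
move=> m /existsP[p rp]; case: pickP => [q rq|/(_ p)]; last by rewrite rp.
by split; [apply: redex_binomial | apply: weight_sort_step | apply: mdeg_sort_step].
Qed.

End Ideal.
End Rewriting.

(** * The upper bound by induced matchings *)

Lemma eq_koszul_vanish (K : fieldType) (N : nat) (I I' : {mpoly K[N]} -> Prop) c :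
  (forall p, I p <-> I' p) -> koszul_vanish I c -> koszul_vanish I' c.
Proof.
move=> eqI van v hv Iv; have [|w Iw] := van v hv; first by move=> A; apply/eqI.
by exists w => A; apply/eqI.
Qed.

Lemma eq_koszul_vanish_monomial (K : fieldType) (N : nat) (U U' : pred 'X_{1..N}) c : U =1 U' ->
  koszul_vanish (@monomial_ideal K N U) c -> koszul_vanish (@monomial_ideal K N U') c.
Proof. by move=> eqU; apply: eq_koszul_vanish => p; split=> Ip m /Ip; rewrite eqU. Qed.

Section UpperBound.
Variables (K : fieldType) (n : nat) (e : rel 'I_n).
Hypotheses (e_sym : symmetric e) (e_closed : closed_labeling e).
Local Notation mon := 'X_{1..(n + n)%N}.
Local Notation X i := (lshift n i).
Local Notation Y i := (rshift n i).
Local Notation up := (up_edge e).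
Implicit Types (V : {set 'I_(n + n)}) (M : {set 'I_n * 'I_n}) (p q : 'I_n * 'I_n).

(** Induced matchings of the bipartite graph joining x_i to y_j for each edge i < j;
    a pair stands for the edge between x_(p.1) and y_(p.2). Taking p and q with the
    same first or second entry shows that distinct pairs share no vertex. *)
Definition induced_matching M :=
  [forall p in M, up p.1 p.2] &&
  [forall p in M, forall q in M, up p.1 q.2 ==> (p == q)].
Definition avoids V M := [forall p in M, (X p.1 \notin V) && (Y p.2 \notin V)].

(** The edge ideal plus the variables in V: a family that is closed under the
    colon by an x_i and the addition of a variable. *)
Definition edge_var_mono V : pred mon := fun m => var_mono V m || edge_mono e m.

Lemma edge_var_upclosed V : upclosed (edge_var_mono V).
Proof.
move=> m m' /orP[/var_mono_upclosed h|/edge_mono_upclosed h].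
  by rewrite /edge_var_mono h.
by rewrite /edge_var_mono h orbT.
Qed.

(** The neighbourhoods of the x_i, seen from y_j, grow with i: closedness at j gives
    the edge a i, and closedness at a then gives the edge i b. *)
Lemma up_edge_nested a i j b :
  up a j -> up i j -> up a b -> (a < i)%N -> (j < b)%N -> up i b.
Proof.
move=> /andP[aj eaj] /andP[ij eij] /andP[ab eab] ai jb.
have eai : e a i.
  by apply: (e_closed (i := j)); rewrite ?(e_sym j) ?aj ?ij ?orbT // neq_ltn ai.
have ib : (i < b)%N by apply: ltn_trans jb.
by rewrite /up_edge ib; apply: (e_closed (i := a)); rewrite ?ai ?ab // neq_ltn ib.
Qed.

Definition up_nbrs i : {set 'I_(n + n)} := [set Y j | j in [set j | up i j]].

Lemma edge_var_colon V i m : X i \notin V ->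
  edge_var_mono V (m + U_(X i))%MM = edge_var_mono (V :|: up_nbrs i) m.
Proof.
move=> iV; apply/idP/idP.
  case/orP => [/existsP[k /andP[kV]]|/existsP[[a b] /and3P[/= R gtX gtY]]].
    rewrite mnmDE mnm1E; case: eqP kV iV => [<- ->//|_ kV _]; rewrite addn0 => gt0.
    by apply/orP; left; apply/existsP; exists k; rewrite inE kV.
  move: gtX gtY; rewrite !mnmDE !mnm1E eq_lrshift addn0 => gtX gtY.
  rewrite eq_lshift in gtX; case: eqP gtX => [eqi _|_].
    apply/orP; left; apply/existsP; exists (Y b); rewrite gtY andbT inE.
    by apply/orP; right; apply/imsetP; exists b => //; rewrite inE eqi.
  rewrite addn0 => gtX; apply/orP; right; apply/existsP; exists (a, b).
  by rewrite /redex /= R gtX.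
case/orP => [/existsP[k /andP[]]|red]; last first.
  by apply/orP; right; apply: edge_mono_upclosed.
rewrite inE => /orP[kV|/imsetP[b]]; last rewrite inE => R eqk; move=> gt0.
  apply/orP; left; apply: var_mono_upclosed; apply/existsP; exists k.
  by rewrite kV.
apply/orP; right; apply/existsP; exists (i, b).
by rewrite /redex /= R !mnmDE mnm1E eqxx addn1 -eqk ltn_addr.
Qed.

Lemma edge_var_add V k m :
  edge_var_mono V m || (0 < m k)%N = edge_var_mono (k |: V) m.
Proof.
rewrite /edge_var_mono orbAC; congr (_ || _); apply/idP/idP.
  case/orP => [/existsP[l /andP[lV gt0]]|gt0]; apply/existsP; [exists l|exists k].
    by rewrite !inE lV orbT.
  by rewrite !inE eqxx.
case/existsP => l /andP[]; rewrite !inE => /orP[/eqP->->|lV gt0]; rewrite ?orbT //.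
by apply/orP; left; apply/existsP; exists l; rewrite lV.
Qed.

(** Among the edges that avoid V take one with j minimal, and then i maximal for this
    j. By [up_edge_nested] no remaining edge meets the neighbours of y_j once those
    of x_i are killed, so x_i y_j extends every induced matching of the colon ideal
    by x_i, whose matching number is thus smaller by one. *)
Lemma koszul_vanish_edge_var V r c :
    (forall M, induced_matching M -> avoids V M -> (#|M| <= r)%N) -> (r < c)%N ->
  koszul_vanish (@monomial_ideal K _ (edge_var_mono V)) c.
Proof.
have [b] := ubnP #|~: V|; elim: b V r c => // b IHb V r c; rewrite ltnS => leb matV lt_rc.
pose alive p := [&& up p.1 p.2, X p.1 \notin V & Y p.2 \notin V].
case: (pickP alive) => [p0 p0_alive|dead]; last first.
  apply: eq_koszul_vanish_monomial (@koszul_vanish_vars K _ V c _);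
    last exact: leq_ltn_trans lt_rc.
  move=> m; apply/idP/orP => [|[//|/existsP[p /and3P[R gtX gtY]]]]; first by left.
  have := dead p; rewrite /alive R /= => /negbT; rewrite negb_and !negbK.
  by case/orP => inV; apply/existsP; [exists (X p.1)|exists (Y p.2)]; rewrite inV.
pose p1 := [arg min_(p < p0 | alive p) p.2].
have [alive_p1 min_p1] : alive p1 /\ forall p, alive p -> (p1.2 <= p.2)%N.
  by rewrite /p1; case: arg_minnP => // p ap mp; split.
pose j := p1.2; have alive1 : alive (p1.1, j) by rewrite -surjective_pairing.
pose i := [arg max_(a > p1.1 | alive (a, j)) a].
have [/and3P[/= Rij iV jV] max_i] : alive (i, j) /\ forall a, alive (a, j) -> (a <= i)%N.
  by rewrite /i; case: arg_maxnP => // a aa ma; split.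
have jN : Y j \in up_nbrs i by apply/imsetP; exists j => //; rewrite inE.
case: c lt_rc => // c; rewrite ltnS => le_rc.
have matching_cons M : induced_matching M -> avoids (V :|: up_nbrs i) M -> (#|M| < r)%N.
  case/andP => /forall_inP edgeM /forall_inP/= indM /forall_inP avM.
  have notN p : p \in M -> ~~ up i p.2.
    move/avM => /andP[_]; apply: contra => R; rewrite inE; apply/orP; right.
    by apply/imsetP; exists p.2 => //; rewrite inE.
  have ijM : (i, j) \notin M by apply/negP => /notN; rewrite /= Rij.
  have notj p : p \in M -> ~~ up p.1 j.
    move=> pM; apply/negP => Rpj.
    have /andP[] := avM p pM; rewrite !inE !negb_or => /andP[p1V _] /andP[p2V _].
    have : (p.1 <= i)%N by apply: max_i; rewrite /alive /= Rpj p1V.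
    rewrite leq_eqVlt => /orP[/eqP/val_inj eqi|lti].
      by have := notN p pM; rewrite -eqi edgeM.
    have : (j <= p.2)%N by apply: min_p1; rewrite /alive edgeM // p1V.
    rewrite leq_eqVlt => /orP[/eqP/val_inj eqj|ltj].
      by have := notN p pM; rewrite -eqj Rij.
    by case/negP: (notN p pM); apply: up_edge_nested Rpj Rij (edgeM p pM) lti ltj.
  suff: (#|(i, j) |: M| <= r)%N by rewrite cardsU1 ijM.
  apply: matV.
    apply/andP; split.
      by apply/forall_inP => p /setU1P[->|/edgeM].
    apply/forall_inP => p /setU1P[->|pM]; apply/forall_inP => q /setU1P[->|qM] //=.
    - by rewrite eqxx implybT.
    - by rewrite (negPf (notN q qM)).
    - by rewrite (negPf (notj p pM)).
    - by have /forall_inP := indM p pM; apply.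
  apply/forall_inP => p /setU1P[->|/avM]; first by rewrite iV jV.
  by rewrite !inE !negb_or => /andP[/andP[-> _] /andP[-> _]].
have r_gt0 : (0 < r)%N.
  apply: leq_ltn_trans (matching_cons set0 _ _) => //; last by apply/forall_inP => p;
    rewrite inE.
  by apply/andP; split; apply/forall_inP => p; rewrite inE.
apply: (@koszul_vanish_colon _ _ _ (X i) _ (@edge_var_upclosed V)).
  apply: eq_koszul_vanish_monomial (fun m => esym (edge_var_colon m iV)) _.
  apply: (IHb _ r.-1); last by rewrite prednK.
    apply: leq_trans leb; rewrite proper_card // properC; apply/properP; split.
      exact: subsetUl.
    by exists (Y j) => //; rewrite inE jN orbT.
  by move=> M indM avM; rewrite -ltnS prednK //; apply: matching_cons.
apply: eq_koszul_vanish_monomial (fun m => esym (edge_var_add V (X i) m)) _.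
apply: (IHb _ r); last by rewrite ltnS.
  apply: leq_trans leb; rewrite proper_card // properC; apply/properP; split.
    exact: subsetU1.
  by exists (X i) => //; rewrite !inE eqxx.
move=> M indM /forall_inP avM; apply: matV => //; apply/forall_inP => p /avM.
by rewrite !inE !negb_or => /andP[/andP[_ ->] /andP[_ ->]].
Qed.

Lemma koszul_vanish_edge_mono r c :
    (forall M, induced_matching M -> (#|M| <= r)%N) -> (r < c)%N ->
  koszul_vanish (@monomial_ideal K _ (edge_mono e)) c.
Proof.
move=> matr lt; apply: eq_koszul_vanish_monomial (@koszul_vanish_edge_var set0 r c _ lt).
  by move=> m; apply: orb_idl => /existsP[k]; rewrite inE.
by move=> M indM _; apply: matr.
Qed.

End UpperBound.

(** * From induced matchings to induced paths *)

Section Paths.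
Variables (n : nat) (e : rel 'I_n).
Hypotheses (e_sym : symmetric e) (e_irr : irreflexive e) (e_closed : closed_labeling e).
Local Notation up := (up_edge e).
Implicit Types (i j k v w c : 'I_n) (s : seq 'I_n) (M : {set 'I_n * 'I_n}).

(** A fan r x y, r x z closes up into an edge, so a first step in the wrong direction
    can be absorbed into the rest of the monotone path. *)
Lemma connect_comparable_step (r : rel 'I_n) v v1 w :
    (forall x y, e x y -> r x y \/ r y x) ->
    (forall x y z, y != z -> r x y -> r x z -> e y z) ->
  e v v1 -> connect r v1 w -> connect r v w \/ connect r w v.
Proof.
move=> total_r fan_r + /connectP[s]; elim: s v v1 => [|v2 s IHs] v v1 evv1 /=.
  by move=> _ ->; case: (total_r _ _ evv1) => /connect1; [left | right].
case/andP=> r12 paths lasts; case: (total_r _ _ evv1) => rv.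
  left; apply: connect_trans (connect1 rv) _; apply/connectP.
  by exists (v2 :: s); rewrite //= r12.
case: (eqVneq v v2) => [->|neq]; first by left; apply/connectP; exists s.
by apply: IHs paths lasts; apply: fan_r rv r12.
Qed.

Lemma edge_up x y : e x y -> up x y \/ up y x.
Proof.
move=> exy; case: (ltngtP x y) => [lt|lt|/val_inj eq]; last by rewrite eq e_irr in exy.
  by left; apply/andP.
by right; apply/andP; rewrite e_sym.
Qed.

(** Prepend the edges of a path one at a time by [connect_comparable_step], for the
    upward relation or its reverse. *)
Lemma connect_up v w : connect e v w -> connect up v w \/ connect up w v.
Proof.
case/connectP => s; elim: s v => [|v1 s IHs] v /=; first by move=> _ ->; left.
case/andP=> evv1 paths lasts; case: (IHs v1 paths lasts) => conn.
  apply: connect_comparable_step evv1 conn => [|x y z yz]; first exact: edge_up.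
  case/andP=> xy exy /andP[xz exz]; apply: (e_closed yz exy exz).
  by rewrite xy xz.
have rev x y : connect (fun x y => up y x) x y = connect up y x.
  exact: (connect_rev up).
have conn' : connect (fun x y => up y x) v1 w by rewrite rev.
suff [] : connect (fun x y => up y x) v w \/ connect (fun x y => up y x) w v.
- by rewrite rev; right.
- by rewrite rev; left.
apply: connect_comparable_step evv1 conn' => [x y /edge_up[]|x y z yz]; try by [left|right].
case/andP=> yx eyx /andP[zx ezx]; apply: (e_closed (i := x) yz); rewrite 1?e_sym //.
by rewrite yx zx orbT.
Qed.

Lemma connect_up_le v w : connect up v w -> (v <= w)%N.
Proof.
case/connectP => s; elim: s v => [|v1 s IHs] v /=; first by move=> _ ->.
by case/andP=> /andP[lt _] paths lasts; apply: leq_trans (ltnW lt) (IHs _ paths lasts).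
Qed.

Lemma connect_lt_up v w : connect e v w -> (v < w)%N -> connect up v w.
Proof. by case/connect_up => // /connect_up_le; rewrite leqNgt => /negP. Qed.

(** Inside a component neighbourhoods are intervals: walk along an increasing path
    from i to k, each vertex of which is adjacent to j by closedness. *)
Lemma edge_interval i j k : e i j -> connect e i k -> (i < k)%N -> (k < j)%N ->
  e i k /\ e k j.
Proof.
move=> eij conn ik kj; suff ekj : e k j.
  split=> //; apply: (e_closed (i := j)); rewrite ?(e_sym j) //.
    by rewrite neq_ltn ik.
  by rewrite (ltn_trans ik kj) kj orbT.
have /connectP[s paths lasts] := connect_lt_up conn ik.
elim: s i {ik conn} eij paths lasts => [|i1 s IHs] i eij /=; first by move=> _ ->.
case/andP=> /andP[ii1 eii1] paths lasts; apply: (IHs _ _ paths lasts).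
have i1k : (i1 <= k)%N by apply: connect_up_le; apply/connectP; exists s.
have i1j : (i1 < j)%N by apply: leq_ltn_trans kj.
apply: (e_closed (i := i)) => //; first by rewrite neq_ltn i1j.
by rewrite ii1 (ltn_trans ii1).
Qed.

(** The largest neighbour above v, or v itself; by [le_reach] it determines the
    neighbours above v in a component. *)
Definition reach v : 'I_n := [arg max_(k > v | (k == v) || up v k) nat_of_ord k].

Lemma reachP v : [/\ (v <= reach v)%N, forall k, up v k -> (k <= reach v)%N
  & (v < reach v)%N -> up v (reach v)].
Proof.
rewrite /reach; case: arg_maxnP => [|k /orP Pk maxk]; first by rewrite eqxx.
split=> [|j vj|]; [by apply: maxk; rewrite eqxx | by apply: maxk; rewrite vj orbT|].
by case: Pk => [/eqP->|//]; rewrite ltnn.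
Qed.

Lemma le_reach v k : connect e v k -> (v < k)%N -> up v k = (k <= reach v)%N.
Proof.
move=> conn vk; have [_ maxv edgev] := reachP v; apply/idP/idP => [/maxv //|].
rewrite leq_eqVlt => /orP[/eqP/val_inj eq|lt]; first by rewrite eq edgev // -eq.
have /andP[_ e1] := edgev (ltn_trans vk lt).
by have [evk _] := edge_interval e1 conn vk lt; apply/andP.
Qed.

Lemma reach_mono v w : connect e v w -> (v <= w)%N -> (reach v <= reach w)%N.
Proof.
move=> conn; rewrite leq_eqVlt => /orP[/eqP/val_inj -> //|vw].
have [lew maxw _] := reachP w; have [_ _ edgev] := reachP v.
case: (leqP (reach v) w) => [/leq_trans->//|lt]; apply: maxw; rewrite /up_edge lt.
by have /andP[_ e1] := edgev (ltn_trans vw lt); have [] := edge_interval e1 conn vw lt.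
Qed.

Lemma connect_reach v : connect e v (reach v).
Proof.
have [le _ edgev] := reachP v; move: le; rewrite leq_eqVlt => /orP[/eqP/val_inj <- //|].
by move/edgev => /andP[_ /connect1].
Qed.

Lemma reach_reach v w : connect e v w -> (reach v < w)%N -> (reach v < reach (reach v))%N.
Proof.
move=> conn lt; have conn' : connect e (reach v) w.
  by apply: connect_trans conn; rewrite sym_connect_sym // connect_reach.
have /connectP[[|u s] /= ] := connect_lt_up conn' lt.
  by move=> _ eq; rewrite eq ltnn in lt.
case/andP=> up_u _ _; have [_ max_reach _] := reachP (reach v).
by apply: leq_trans (max_reach _ up_u); case/andP: up_u.
Qed.

(** An increasing path is induced as soon as each vertex lies beyond the reach of the
    vertex two places before it; lo stands for the reach of the vertex before c. *)
Fixpoint sparse_path (lo : nat) c s : bool :=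
  if s is v :: s' then [&& (lo < v)%N, up c v & sparse_path (reach c) v s']
  else true.

Lemma matching_order M p q : induced_matching e M -> p \in M -> q \in M -> q != p ->
    (p.1 <= q.1)%N -> connect e p.1 q.1 ->
  [/\ (p.1 < q.1)%N, (p.2 <= q.1)%N & (reach p.1 < q.2)%N].
Proof.
case/andP=> /forall_inP edgeM /forall_inP/= indM pM qM neq le conn.
have npq : ~~ up p.1 q.2.
  by apply: contra neq => R; rewrite eq_sym; apply: (implyP (forall_inP (indM p pM) q qM)).
have nqp : ~~ up q.1 p.2.
  by apply: contra neq => R; apply: (implyP (forall_inP (indM q qM) p pM)).
have /andP[ltp ep] := edgeM p pM; have Rq := edgeM q qM; have /andP[ltq eq] := Rq.
have lt : (p.1 < q.1)%N.
  rewrite ltn_neqAle le andbT; apply: contraNneq npq => /val_inj ->.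
  exact: edgeM.
split=> //.
  rewrite leqNgt; apply/negP => ltqp; have [_ e'] := edge_interval ep conn lt ltqp.
  by case/negP: nqp; apply/andP.
rewrite ltnNge -le_reach //; last exact: ltn_trans lt ltq.
exact: connect_trans conn (connect1 eq).
Qed.

Lemma induced_matchingS M M' : M' \subset M -> induced_matching e M -> induced_matching e M'.
Proof.
move=> /subsetP sub /andP[/forall_inP edgeM /forall_inP/= indM]; apply/andP; split.
  by apply/forall_inP => p /sub/edgeM.
apply/forall_inP => p /sub pM; apply/forall_inP => q /sub qM.
exact: (forall_inP (indM p pM)).
Qed.

Lemma min_first M : M != set0 -> exists2 p, p \in M & forall q, q \in M -> (p.1 <= q.1)%N.
Proof.
case/set0Pn => p0 p0M; pose p := [arg min_(p < p0 in M) nat_of_ord p.1].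
by exists p; rewrite /p; case: arg_minnP.
Qed.

(** Greedy construction. If p is the first pair of the matching, the next vertex is
    the smaller of p.1 and reach c. It is beyond lo, adjacent to c and has a larger
    reach than c, and the remaining pairs lie far enough to continue. *)
Lemma sparse_path_of_matching M lo c :
    (c <= lo)%N -> (lo < reach c)%N -> induced_matching e M ->
    (forall p, p \in M -> [/\ (lo < p.1)%N, (reach c < p.2)%N & connect e c p.1]) ->
  exists s, [/\ size s = #|M|.+1, sparse_path lo c s & all (connect e c) s].
Proof.
have [b] := ubnP #|M|; elim: b M lo c => // b IHb M lo c; rewrite ltnS => leb.
move=> le_lo lt_lo indM boundM; have [_ _ edge_c] := reachP c.
case: (eqVneq M set0) => [->|/min_first[p pM minp]].
  exists [:: reach c]; rewrite cards0 /= lt_lo connect_reach edge_c //.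
  exact: leq_ltn_trans lt_lo.
have [lo_p c_p conn_p] := boundM p pM.
have edgep : up p.1 p.2 by case/andP: indM => /forall_inP /(_ p pM).
pose v := if (p.1 <= reach c)%N then p.1 else reach c.
have v_le_p : (v <= p.1)%N 
  by rewrite /v; case: ifP => // /negbT; rewrite -ltnNge => /ltnW.
have v_le_c : (v <= reach c)%N by rewrite /v; case: ifP.
have lo_v : (lo < v)%N by rewrite /v; case: ifP.
have conn_v : connect e c v by rewrite /v; case: ifP => // _; apply: connect_reach.
have conn_vp : connect e v p.1.
  by apply: connect_trans conn_p; rewrite sym_connect_sym.
have reach_v : (reach c < reach v)%N.
  rewrite /v; case: ifP => _.
    by apply: leq_trans c_p _; have [_ maxp _] := reachP p.1; apply: maxp.
  apply: reach_reach c_p; apply: connect_trans conn_p _.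
  by case/andP: edgep => _ /connect1.
have sub : M :\ p \subset M by apply: subD1set.
have bound' q : q \in M :\ p -> [/\ (reach c < q.1)%N, (reach v < q.2)%N & connect e v q.1].
  case/setD1P => neq qM; have [_ _ conn_q] := boundM q qM.
  have conn_pq : connect e p.1 q.1.
    by apply: connect_trans conn_q; rewrite sym_connect_sym.
  have [_ le2 lt2] := matching_order indM pM qM neq (minp q qM) conn_pq.
  split; first exact: leq_trans c_p le2.
    by apply: leq_ltn_trans lt2; apply: reach_mono.
  exact: connect_trans conn_vp conn_pq.
have cardM : #|M| = #|M :\ p|.+1 by rewrite (cardsD1 p) pM.
have [|s [sz sp conn_s]] := IHb (M :\ p) (reach c) v _ v_le_c reach_v (induced_matchingS sub indM) bound'.
  by rewrite -ltnS -cardM ltnS.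
exists (v :: s); split; first by rewrite /= sz -cardM.
  by rewrite /= lo_v sp andbT le_reach // (leq_ltn_trans le_lo).
rewrite /= conn_v; apply/allP => w /(allP conn_s); exact: connect_trans.
Qed.

Lemma sparse_path_lt d lo c s a b : sparse_path lo c s -> (b <= size s)%N -> (a < b)%N ->
  (nth d (c :: s) a < nth d (c :: s) b)%N.
Proof.
move=> sp leb ltab; have : sorted (fun x y : 'I_n => (x < y)%N) (c :: s).
  elim: s lo c sp {leb} => //= v s IHs lo c /and3P[_ /andP[-> _]]; exact: IHs.
move=> sorted_s; apply: (sorted_ltn_nth _ d sorted_s) => //.
- by move=> x y z; apply: ltn_trans.
- by rewrite inE /= ltnS (leq_trans (ltnW ltab)).
Qed.

Lemma sparse_path_edge d lo c s a : sparse_path lo c s -> (a < size s)%N ->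
  up (nth d (c :: s) a) (nth d (c :: s) a.+1).
Proof.
elim: s lo c a => // v s IHs lo c [|a] /= /and3P[_ up_cv sp] //; rewrite ltnS => lta.
exact: IHs sp lta.
Qed.

Lemma sparse_path_far d lo c s a : sparse_path lo c s -> (a.+1 < size s)%N ->
  (reach (nth d (c :: s) a) < nth d (c :: s) a.+2)%N.
Proof.
elim: s lo c a => // v s IHs lo c [|a] /= /and3P[_ up_cv sp]; rewrite ltnS => lta.
  by case: s sp lta {IHs} => //= w s /and3P[].
exact: IHs sp lta.
Qed.

Lemma sparse_path_nonedge d lo c s a b : sparse_path lo c s ->
  (b <= size s)%N -> (a.+1 < b)%N -> ~~ e (nth d (c :: s) a) (nth d (c :: s) b).
Proof.
move=> sp leb ltab; apply/negP => eab.
have lt := sparse_path_lt d sp leb (ltnW ltab).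
have /le_reach eqR : connect e (nth d (c :: s) a) (nth d (c :: s) b) by apply: connect1.
have : up (nth d (c :: s) a) (nth d (c :: s) b) by apply/andP.
rewrite eqR // leqNgt => /negP[].
have far := sparse_path_far d sp (leq_trans ltab leb); apply: leq_trans far _.
move: ltab; rewrite leq_eqVlt => /orP[/eqP -> //|ltab].
exact: ltnW (sparse_path_lt d sp leb ltab).
Qed.

Lemma sparse_path_longest lo c s (C : {set 'I_n}) :
    sparse_path lo c s -> {subset c :: s <= C} ->
  (size s <= longest_induced_path e C)%N.
Proof.
move=> sp subC; pose t : (size s).+1.-tuple 'I_n := in_tuple (c :: s).
have uniq_t : uniq t.
  apply/(uniqP c) => a b; rewrite !inE /= !ltnS => lea leb eq.
  by case: (ltngtP a b) => // lt;
    [have := sparse_path_lt c sp leb lt | have := sparse_path_lt c sp lea lt];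
    rewrite eq ltnn.
have lt_n : (size s < n)%N.
  by have := max_card (mem t); rewrite card_ord (card_uniqP uniq_t).
rewrite /longest_induced_path; apply: (bigmax_sup (Ordinal lt_n)) => //.
apply/existsP; exists t; apply/andP; split; last by apply/allP.
rewrite /induced_path uniq_t; apply/forallP => a; apply/forallP => b.
rewrite !(tnth_nth c) /=; have := ltn_ord a; have := ltn_ord b; rewrite !ltnS => leb lea.
have edge a' b' : (b' <= size s)%N -> (a' < b')%N ->
    e (nth c (c :: s) a') (nth c (c :: s) b') = (b' == a'.+1).
  move=> le lt; case: eqP => [eq|neq].
    by rewrite eq; rewrite eq in le; case/andP: (sparse_path_edge c sp le).
  by apply/negbTE/(sparse_path_nonedge c sp) => //; lia.
case: (ltngtP a b) => [lt|lt|eq].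
- have /negPf-> : nat_of_ord a != b.+1 by lia.
  by rewrite orbF edge.
- have /negPf-> : nat_of_ord b != a.+1 by lia.
  by rewrite e_sym edge.
- by rewrite eq e_irr orbb; have /negPf-> : nat_of_ord b != b.+1 by lia.
Qed.

Lemma matching_longest M (C : {set 'I_n}) :
    induced_matching e M -> {in M, forall p, p.1 \in C} ->
    {in C &, forall v w, connect e v w} ->
    (forall v w, v \in C -> connect e v w -> w \in C) ->
  (#|M| <= longest_induced_path e C)%N.
Proof.
move=> indM MC connC closedC; case: (eqVneq M set0) => [->|/min_first[p pM minp]].
  by rewrite cards0.
have edgep : up p.1 p.2 by case/andP: indM => /forall_inP /(_ p pM).
have bound q : q \in M :\ p -> [/\ (p.1 < q.1)%N, (reach p.1 < q.2)%N & connect e p.1 q.1].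
  case/setD1P => neq qM; have conn := connC _ _ (MC p pM) (MC q qM).
  by have [] := matching_order indM pM qM neq (minp q qM) conn.
have lt_reach : (p.1 < reach p.1)%N.
  have [_ maxp _] := reachP p.1; apply: leq_trans (maxp _ edgep).
  by case/andP: edgep.
have [s [sz sp conn]] := sparse_path_of_matching (leqnn _) lt_reach
  (induced_matchingS (subD1set M p) indM) bound.
rewrite (cardsD1 p) pM add1n -sz; apply: sparse_path_longest sp _ => v.
rewrite inE => /orP[/eqP->|/(allP conn)]; [exact: MC | apply: closedC; exact: MC].
Qed.

Lemma components_partition : partition (components e) [set: 'I_n].
Proof.
apply: equivalence_partitionP => x y z _ _ _.
by split=> [|xy]; [apply: connect0 | exact: (same_connect (sym_connect_sym e_sym) xy)].
Qed.

Lemma component_connect C : C \in components e -> {in C &, forall v w, connect e v w}.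
Proof.
case/imsetP => x _ -> v w; rewrite !inE => xv xw.
by apply: connect_trans xw; rewrite sym_connect_sym.
Qed.

Lemma component_closed C v w : C \in components e -> v \in C -> connect e v w -> w \in C.
Proof. by case/imsetP => x _ ->; rewrite !inE; apply: connect_trans. Qed.

Lemma matching_le_longest M : induced_matching e M ->
  (#|M| <= \sum_(C in components e) longest_induced_path e C)%N.
Proof.
move=> indM; have /and3P[/eqP cov triv _] := components_partition.
rewrite -sum1_card (partition_big (fun p => pblock (components e) p.1) (mem (components e))) /=.
  apply: leq_sum => C CP; rewrite sum1dep_card; set MC := [set p | _].
  apply: matching_longest.
  - by apply: induced_matchingS indM; apply/subsetP => p; rewrite inE => /andP[].
  - by move=> p; rewrite inE => /andP[_ /eqP <-]; rewrite mem_pblock cov.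
  - exact: component_connect.
  - by move=> v w; apply: component_closed.
by move=> p _; apply: pblock_mem; rewrite cov.
Qed.

End Paths.

(** * A nonzero Koszul class from induced paths *)

Section LowerBound.
Variables (K : fieldType) (n : nat) (e : rel 'I_n).
Hypotheses (e_sym : symmetric e) (e_irr : irreflexive e).
Local Notation N := (n + n)%N.
Local Notation S := {mpoly K[N]}.
Local Notation E := {ffun {set 'I_N} -> S}.
Local Notation mon := 'X_{1..N}.
Local Notation X i := (lshift n i).
Local Notation Y i := (rshift n i).
Local Notation J := (binomial_edge_ideal K e).
Implicit Types (m : mon) (k : 'I_N) (t s : nat).

Variables (d : 'I_n) (w : seq 'I_n).
Hypotheses (w_uniq : uniq w)
  (w_path : forall a b, (a < size w)%N -> (b < size w)%N ->
     e (nth d w a) (nth d w b) -> a = b.+1 \/ b = a.+1).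
Local Notation W a := (nth d w a).

(** The edge from the vertex of index t - 2 to that of index t - 1 carries the number t.
    With this shift 0 and 1 never number an edge, and there is a free number between
    the last edge of a path and the first edge of the next one. *)
Definition is_step t := [&& (2 <= t)%N, (t <= size w)%N & e (W (t - 2)) (W (t - 1))].
Definition steps := [seq t <- iota 0 (size w).+1 | is_step t].

Lemma mem_steps t : (t \in steps) = is_step t.
Proof.
rewrite mem_filter mem_iota add0n ltnS /=; case: (boolP (is_step t)) => //=.
by case/and3P.
Qed.

Lemma steps_uniq : uniq steps.
Proof. by rewrite filter_uniq ?iota_uniq. Qed.

(** The number of the new variable z_t to which a variable specializes: x_v takes the
    number of the edge that leaves v, y_v that of the edge that enters v, and 0
    encodes the specialization to 0. *)
Definition position k : nat :=
  let t := match split k with inl v => (index v w).+2 | inr v => (index v w).+1 end in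
  if is_step t then t else 0%N.

Lemma positionX v : position (X v) = if is_step (index v w).+2 then (index v w).+2 else 0%N.
Proof. by rewrite /position -[X v]/(unsplit (inl v)) unsplitK. Qed.

Lemma positionY v : position (Y v) = if is_step (index v w).+1 then (index v w).+1 else 0%N.
Proof. by rewrite /position -[Y v]/(unsplit (inr v)) unsplitK. Qed.

Lemma is_step_pos k : (0 < position k)%N -> is_step (position k).
Proof. by rewrite /position; case: ifP. Qed.

Lemma positionXW t : is_step t -> position (X (W (t - 2))) = t.
Proof.
move=> et; have /and3P[t2 tw _] := et.
rewrite positionX index_uniq //; last by apply: leq_trans tw; lia.
have -> : (t - 2).+2 = t by lia.
by rewrite et.
Qed.

Lemma positionYW t : is_step t -> position (Y (W (t - 1))) = t.
Proof.
move=> et; have /and3P[t2 tw _] := et.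
rewrite positionY index_uniq //; last by apply: leq_trans tw; lia.
have -> : (t - 1).+1 = t by lia.
by rewrite et.
Qed.

(** The specialized monomial, a multiset of positions, is compared with the multiset
    [steps] through the convex functions t |-> max (t - s, 0). Replacing z_t ^ 2 by
    z_(t-1) z_(t+1) adds 1 to the potential at s = t and leaves it unchanged
    elsewhere. *)
Definition potential m s : nat := \sum_k m k * (position k - s).
Definition multiplicity m s : nat := \sum_k m k * (position k == s).
Definition bound s : nat := \sum_(t <- steps) (t - s).

Lemma potential_second_diff m s :
  (potential m s + potential m s.+2 = 2 * potential m s.+1 + multiplicity m s.+1)%N.
Proof.
rewrite /potential /multiplicity big_distrr -!big_split; apply: eq_bigr => k _ /=.
by case: eqP => [->|]; nia.
Qed.

Lemma bound_second_diff s : (bound s + bound s.+2 = 2 * bound s.+1 + is_step s.+1)%N.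
Proof.
have -> : (is_step s.+1 : nat) = (\sum_(t <- steps) (t == s.+1))%N.
  rewrite -mem_steps -(count_uniq_mem _ steps_uniq) -sum1_count big_mkcond.
  by apply: eq_bigr => t _ /=; case: eqP.
rewrite /bound big_distrr -!big_split; apply: eq_bigr => t _ /=.
by case: eqP => [->|]; lia.
Qed.

Lemma potentialD m m' s : potential (m + m')%MM s = (potential m s + potential m' s)%N.
Proof. by rewrite /potential -big_split; apply: eq_bigr => k _; rewrite mnmDE mulnDl. Qed.

Lemma potentialU k s : potential U_(k)%MM s = (position k - s)%N.
Proof.
rewrite /potential (bigD1 k) //= mnm1E eqxx mul1n big1 ?addn0 // => l neq.
by rewrite mnm1E eq_sym (negPf neq).
Qed.

Lemma multiplicityD m m' s : multiplicity (m + m')%MM s =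
  (multiplicity m s + multiplicity m' s)%N.
Proof. by rewrite /multiplicity -big_split; apply: eq_bigr => k _; rewrite mnmDE mulnDl. Qed.

Lemma multiplicityU k s : multiplicity U_(k)%MM s = (position k == s).
Proof.
rewrite /multiplicity (bigD1 k) //= mnm1E eqxx mul1n big1 ?addn0 // => l neq.
by rewrite mnm1E eq_sym (negPf neq).
Qed.

Definition alive m := [forall k, (0 < m k)%N ==> (0 < position k)%N].
Definition balanced m s := if is_step s then (potential m s <= bound s)%N else potential m s == bound s.
(** The multiset of positions is majorized by [steps], on each path separately. The
    product of all the z_t is of this kind, and the condition is invariant under the
    exchange of z_t ^ 2 and z_(t-1) z_(t+1). *)
Definition admissible m := alive m && all (balanced m) (iota 0 (size w).+2).

Lemma balanced_le m s : balanced m s -> (potential m s <= bound s)%N.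
Proof. by rewrite /balanced; case: ifP => // _ /eqP ->. Qed.

Lemma aliveD m m' : alive (m + m')%MM = alive m && alive m'.
Proof.
apply/forallP/andP => [al|[/forallP al /forallP al'] k].
  by split; apply/forallP => k; apply/implyP => gt0; have := al k;
    rewrite mnmDE addn_gt0 gt0 ?orbT.
by rewrite mnmDE addn_gt0; apply/implyP => /orP[]; apply/implyP.
Qed.

Lemma aliveU k : alive U_(k)%MM = (0 < position k)%N.
Proof.
apply/forallP/idP => [/(_ k)|gt0 l]; first by rewrite mnm1E eqxx.
by rewrite mnm1E; case: eqP => [<-|//]; rewrite gt0.
Qed.

Lemma multiplicity_eq0 m s : alive m -> ~~ is_step s.+1 -> multiplicity m s.+1 = 0%N.
Proof.
move=> /forallP al neg; rewrite /multiplicity big1 // => k _.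
case: (posnP (m k)) => [->//|gt0]; have := al k; rewrite gt0 => /= /is_step_pos.
by case: eqP => [->|]; rewrite ?muln0 // (negPf neg).
Qed.

(** The second difference of the potential at t is at least 2, while that of the bound
    is 1, so the potential is strictly below the bound at t. It could not be if t - 1
    or t + 1 were unused, since equality at an unused number spreads to its
    neighbours. *)
Lemma admissible_repeated m t : admissible m -> is_step t -> (2 <= multiplicity m t)%N ->
  [/\ is_step t.-1, is_step t.+1 & (potential m t < bound t)%N].
Proof.
case/andP=> al /allP bal et m2; have /and3P[t2 tw _] := et.
have bal' s : (s <= (size w).+1)%N -> balanced m s by move=> le; apply: bal; rewrite mem_iota.
case: t => [|[|t]] // in et m2 t2 tw *.
have [b0 b1 b2 b3] : [/\ balanced m t, balanced m t.+1, balanced m t.+2 & balanced m t.+3].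
  by split; apply: bal'; lia.
have [F1 F2] := (potential_second_diff m t, potential_second_diff m t.+1).
have [B1 B2] := (bound_second_diff t, bound_second_diff t.+1).
rewrite et in B2.
have := balanced_le b0; have := balanced_le b1; have := balanced_le b2; have := balanced_le b3.
split; last by lia.
  case: (boolP (is_step t.+1)) => // neg;
    rewrite (negPf neg) (multiplicity_eq0 al neg) in F1 B1.
  by move: b1; rewrite /balanced (negPf neg) => /eqP; lia.
(* The number t.+4 may lie outside the tested range, but the potential is 0 there. *)
case: (boolP (is_step t.+3)) => // neg.
have b4 : (potential m t.+4 <= bound t.+4)%N.
  case: (leqP t.+4 (size w).+1) => [le|lt]; first by apply/balanced_le/bal'.
  rewrite /potential big1 // => k _;
    case: (posnP (position k)) => [->|/is_step_pos/and3P[_ le _]]; first by rewrite muln0.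
  by apply/eqP; rewrite muln_eq0 subn_eq0 (leq_trans le) ?orbT //; lia.
have [F3 B3] := (potential_second_diff m t.+2, bound_second_diff t.+2).
rewrite (negPf neg) (multiplicity_eq0 al neg) in F3 B3.
by move: b3; rewrite /balanced (negPf neg) => /eqP; lia.
Qed.

Lemma admissible_swap m t k1 k2 k3 k4 : is_step t -> position k1 = t -> position k2 = t ->
    position k3 = (if is_step t.+1 then t.+1 else 0%N) ->
      position k4 = (if is_step t.-1 then t.-1 else 0%N) ->
  admissible (m + (U_(k1) + U_(k2)))%MM = admissible (m + (U_(k3) + U_(k4)))%MM.
Proof.
move=> et p1 p2 p3 p4; have /and3P[t2 tw _] := et.
have rep : admissible (m + (U_(k1) + U_(k2)))%MM ->
    [/\ is_step t.-1, is_step t.+1 & (potential (m + (U_(k1) + U_(k2)))%MM t < bound t)%N].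
  by move=> /admissible_repeated; apply=> //;
    rewrite !multiplicityD !multiplicityU p1 p2 eqxx; lia.
case: (boolP (is_step t.-1 && is_step t.+1)) => [/andP[e1 e2]|neg]; last first.
  transitivity false.
    by apply/negP => /rep[e1 e2 _]; rewrite e1 e2 in neg.
  apply/esym/negP => /andP[]; rewrite !aliveD !aliveU p3 p4.
  by move: neg; case: ifP => _; case: ifP => _; rewrite ?andbF.
rewrite e1 e2 in p3 p4.
have alive_eq : alive (m + (U_(k1) + U_(k2)))%MM = alive (m + (U_(k3) + U_(k4)))%MM.
  by rewrite !aliveD !aliveU p1 p2 p3 p4; congr (_ && _); apply/andP/andP; lia.
have F_eq s : potential (m + (U_(k3) + U_(k4)))%MM s =
  (potential (m + (U_(k1) + U_(k2)))%MM s + (s == t))%N.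
  rewrite !potentialD !potentialU p1 p2 p3 p4 -!addnA; congr addn.
  by case: eqP => [->|]; lia.
apply/idP/idP => [c12|/andP[al /allP bal]].
  have [_ _ lt] := rep c12; case/andP: c12 => al /allP bal.
  rewrite /admissible -alive_eq al; apply/allP => s /bal; rewrite /balanced F_eq.
  by case: (eqVneq s t) => [->|_]; rewrite ?addn0 // et addn1.
rewrite /admissible alive_eq al; apply/allP => s /bal; rewrite /balanced F_eq.
by case: (eqVneq s t) => [->|_]; rewrite ?addn0 // et addn1 => /ltnW.
Qed.

Lemma admissible_position m k k' : position k = position k' ->
  admissible (U_(k) + m)%MM = admissible (U_(k') + m)%MM.
Proof.
move=> eqp; rewrite /admissible !aliveD !aliveU eqp; congr (_ && _).
by apply: eq_all => s; rewrite /balanced !potentialD !potentialU eqp.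
Qed.

Lemma admissible_dead m k : position k = 0%N -> admissible (U_(k) + m)%MM = false.
Proof. by move=> p0; rewrite /admissible aliveD aliveU p0. Qed.

Lemma admissible_edge m i j : e i j ->
  admissible (m + (U_(X i) + U_(Y j)))%MM = admissible (m + (U_(X j) + U_(Y i)))%MM.
Proof.
have dead v : v \notin w -> position (X v) = 0%N /\ position (Y v) = 0%N.
  rewrite -index_mem -leqNgt => le; rewrite positionX positionY /is_step.
  have /negPf-> : ~~ ((index v w).+2 <= size w)%N by rewrite -ltnNge ltnS leqW.
  have /negPf-> : ~~ ((index v w).+1 <= size w)%N by rewrite -ltnNge ltnS.
  by rewrite !andbF.
have cX v m' : v \notin w -> admissible (m + (U_(X v) + m'))%MM = false.
  by move=> /dead[p0 _]; rewrite addmC -addmA admissible_dead.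
have cY v m' : v \notin w -> admissible (m + (m' + U_(Y v)))%MM = false.
  by move=> /dead[_ p0]; rewrite addmC -addmA addmC -addmA admissible_dead.
move=> eij; case: (boolP (i \in w)) => iw; last by rewrite (cX i) // (cY i).
case: (boolP (j \in w)) => jw; last by rewrite (cY j) // (cX j).
have step i' j' : i' \in w -> j' \in w -> e i' j' -> index j' w = (index i' w).+1 ->
    admissible (m + (U_(X i') + U_(Y j')))%MM = admissible (m + (U_(X j') + U_(Y i')))%MM.
  move=> iw' jw' eij' eqj; set t := (index i' w).+2.
  have et : is_step t.
    rewrite /is_step /t subn2 subn1 /= -eqj !nth_index // eij' andbT.
    by move: jw'; rewrite -index_mem eqj.
  apply: (admissible_swap _ et); first by rewrite positionX -/t et.
  - by rewrite positionY eqj et.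
  - by rewrite positionX eqj.
  - by rewrite positionY.
have := @w_path (index i w) (index j w); rewrite !index_mem !nth_index //.
case/(_ iw jw eij) => eqi; last exact: step.
by rewrite (step j i) // e_sym.
Qed.

(** The functional on S dual to the socle of the complete intersection obtained by
    specialization. *)
Definition test_functional : S -> K := linext (fun m => (admissible m)%:R).

HB.instance Definition _ :=
  GRing.isZmodMorphism.Build S K test_functional (linext_is_additive (fun m => (admissible m)%:R)).

Lemma test_functional_edge_ideal f : J f -> test_functional f = 0.
Proof.
case=> b [c [a [aJ ->]]]; rewrite [LHS]raddf_sum big1 //= => t _.
have [i [j [lt eij ->]]] := aJ t.
rewrite mulrC mulrBl raddfB /= -!mpolyXD /test_functional !linextXM.
apply/eqP; rewrite subr_eq0; apply/eqP/eq_linext => m.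
by rewrite ![(_ + m)%MM]addmC admissible_edge.
Qed.

Lemma test_functional_position k k' p : position k = position k' ->
  test_functional ('X_k * p) = test_functional ('X_k' * p).
Proof.
by move=> eqp; rewrite /test_functional !linextXM; apply: eq_linext => m;
  rewrite (admissible_position _ eqp).
Qed.

Lemma test_functional_dead k p : position k = 0%N -> test_functional ('X_k * p) = 0.
Proof.
move=> p0; rewrite /test_functional linextXM /linext big1 // => m _.
by rewrite admissible_dead // mulr0.
Qed.

Lemma test_functional_diag : test_functional (\prod_(t <- steps) 'X_(X (W (t - 2)))) = 1.
Proof.
rewrite /test_functional mprodXE linextX (_ : admissible _) //.
have Fs s : potential (\sum_(t <- steps) U_(X (W (t - 2))))%MM s = bound s.
  rewrite /bound big_seq [RHS]big_seq; elim/big_rec2: _ => [|t b m tts <-].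
    by rewrite /potential big1 // => k _; rewrite mnm0E.
  by rewrite potentialD potentialU positionXW // -mem_steps.
apply/andP; split; last first.
  by apply/allP => s _; rewrite /balanced Fs leqnn eqxx if_same.
rewrite big_seq; elim/big_rec: _ => [|t m tts al]; first by apply/forallP => k; rewrite mnm0E.
rewrite aliveD aliveU positionXW -?mem_steps // al andbT.
by move: tts; rewrite mem_steps => /and3P[]; lia.
Qed.

(** Contraction with the covector that takes the value 1 on all basis vectors
    specializing to z_t. *)
Definition contract_at t (v : E) : E := \sum_(k | position k == t) contract k v.

Lemma contract_at_is_additive t : zmod_morphism (contract_at t).
Proof. by move=> u v; rewrite /contract_at -sumrB; apply: eq_bigr => k _; rewrite raddfB. Qed.
HB.instance Definition _ t := GRing.isZmodMorphism.Build E E (contract_at t) (contract_at_is_additive t).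

Lemma contract_at_scale t p v : contract_at t (scale_by p v) = scale_by p (contract_at t v).
Proof. by rewrite /contract_at raddf_sum; apply: eq_bigr => k _; rewrite contract_scale. Qed.

Lemma contract_at_koszul_d t v : contract_at t (koszul_d v) = - koszul_d (contract_at t v).
Proof.
rewrite /contract_at [koszul_d (\sum_(_ | _) _)]raddf_sum -sumrN; apply: eq_bigr => k _ /=.
by rewrite koszul_d_contract opprK.
Qed.

Lemma contract_at_anticomm t s v :
  contract_at t (contract_at s v) = - contract_at s (contract_at t v).
Proof.
rewrite /contract_at -sumrN (eq_bigr (fun k => \sum_(l | position l == s) contract k (contract l v))); last first.
  by move=> k _; rewrite raddf_sum.
rewrite exchange_big; apply: eq_bigr => l _ /=; rewrite raddf_sum -sumrN.
by apply: eq_bigr => k _; rewrite contract_anticomm.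
Qed.

Lemma contract_at_twice t v : contract_at t (contract_at t v) = 0.
Proof.
rewrite /contract_at (eq_bigr (fun k => \sum_(l | position l == t) contract k (contract l v))); last first.
  by move=> k _; rewrite raddf_sum.
pose G k l : E := if (position k == t) && (position l == t) then contract k (contract l v) else 0.
rewrite -[RHS](@alternating_sum _ _ G) /G.
- rewrite big_mkcond; apply: eq_bigr => k _; case: ifP => _; last by rewrite big1.
  by rewrite big_mkcond.
- by move=> k; rewrite contract_contract if_same.
- by move=> k l; rewrite andbC contract_anticomm; case: ifP; rewrite ?oppr0.
Qed.

Fixpoint contract_all (r : seq nat) v : E :=
  if r is t :: r' then contract_all r' (contract_at t v) else v.

Lemma contract_all_is_additive r : zmod_morphism (contract_all r).
Proof. by elim: r => //= t r IHr u v; rewrite raddfB IHr. Qed.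
HB.instance Definition _ r := GRing.isZmodMorphism.Build E E (contract_all r) (contract_all_is_additive r).

Lemma contract_all_scale r p v : contract_all r (scale_by p v) = scale_by p (contract_all r v).
Proof. by elim: r v => //= t r IHr v; rewrite contract_at_scale. Qed.

Lemma contract_all_sign r (D : {additive E -> E}) :
    (forall t v, contract_at t (D v) = - D (contract_at t v)) ->
  forall v, D (contract_all r v) = contract_all r (D v) \/ D (contract_all r v) =
    - contract_all r (D v).
Proof.
move=> gD; elim: r => [|t r IHr] v /=; first by left.
by case: (IHr (contract_at t v)) => ->; rewrite gD raddfN ?opprK; [right | left].
Qed.

Lemma contract_at_all r t v : t \in r -> contract_at t (contract_all r v) = 0.
Proof.
elim: r v => //= s r IHr v; rewrite inE => /orP[/eqP->|/IHr //].
have gg u (x : E) : contract_at u (contract_at s x) =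
  - contract_at s (contract_at u x) by apply: contract_at_anticomm.
by case: (contract_all_sign r gg (contract_at s v)) => /= ->;
  rewrite contract_at_twice raddf0 ?oppr0.
Qed.

Lemma coeffs_in_contract_all r v : coeffs_in J v -> coeffs_in J (contract_all r v).
Proof.
have Jid : is_ideal J by apply: ideal_gen_is_ideal.
elim: r v => //= t r IHr v Jv; apply: IHr; rewrite /contract_at.
by elim/big_ind: _ => [|u u'|k _];
  [exact: coeffs_in0 | exact: coeffs_inD | exact: coeffs_in_contract].
Qed.

(** On a chain killed by every [contract_at], the terms of the boundary cancel within
    each group of variables with the same specialization. *)
Lemma test_functional_koszul_d u : (forall t, t \in steps -> contract_at t u = 0) ->
  test_functional (koszul_d u set0) = 0.
Proof.
move=> gu0; rewrite /koszul_d sum_ffunE [LHS]raddf_sum /=.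
rewrite (bigID (fun k => 0 < position k)%N) /= [Z in _ + Z]big1 ?addr0; last first.
  by move=> k; rewrite -eqn0Ngt => /eqP p0; rewrite ffunE test_functional_dead.
have le_pos k : (position k < (size w).+1)%N.
  by rewrite ltnS; case: (posnP (position k)) => [->//|/is_step_pos/and3P[]].
rewrite (partition_big (fun k => Ordinal (le_pos k)) xpredT) //= big1 // => s _.
case: (boolP (is_step s)) => es; last first.
  by rewrite big1 // => k /andP[/is_step_pos ek /eqP eqs]; rewrite -eqs ek in es.
rewrite (eq_bigr (fun k => test_functional ('X_(X (W (s - 2))) * contract k u set0)));
  last first.
  move=> k /andP[_ /eqP eqs]; rewrite ffunE; apply: test_functional_position.
  by rewrite positionXW // -eqs.
rewrite -raddf_sum -mulr_sumr /=.
rewrite (_ : \sum_(k | _) _ = contract_at s u set0).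
  by rewrite gu0 ?mem_steps // ffunE mulr0 [LHS]raddf0.
rewrite /contract_at sum_ffunE; apply: eq_bigl => k; rewrite -val_eqE /= andb_idl // => /eqP ->.
by case/and3P: es; lia.
Qed.

(** Wedge product with the linear chain x_i e_(y_j) - y_i e_(x_j), where i j is the
    edge numbered t; the boundary of this chain is the binomial of the edge. *)
Definition wedge_edge t (u : E) : E :=
  scale_by 'X_(X (W (t - 2))) (wedge (Y (W (t - 1))) u) -
  scale_by 'X_(Y (W (t - 2))) (wedge (X (W (t - 1))) u).
Definition path_cycle (r : seq nat) : E := foldr wedge_edge (ext_basis K set0) r.

Lemma wedge_edge0 t : wedge_edge t 0 = 0.
Proof. by rewrite /wedge_edge !raddf0 addr0. Qed.

Lemma koszul_d_wedge_edge t u :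
  koszul_d (wedge_edge t u) = scale_by ('X_(X (W (t - 2))) * 'X_(Y (W (t - 1))) -
  'X_(Y (W (t - 2))) * 'X_(X (W (t - 1)))) u - wedge_edge t (koszul_d u).
Proof.
rewrite /wedge_edge raddfB /= !koszul_d_scale !koszul_d_wedge; apply/ffunP => A; rewrite !ffunE.
ring.
Qed.

(** The covector numbered s takes the value 0 on the chain of the edge t for s < t, so
    contractions in increasing order leave only the diagonal product of the x_i. *)
Lemma contract_at_wedge_edge t s u : is_step t -> is_step s -> (s <= t)%N ->
  contract_at s (wedge_edge t u) =
    (if s == t then scale_by 'X_(X (W (t - 2))) u else 0) - wedge_edge t (contract_at s u).
Proof.
move=> et es le; have /and3P[t2 tw _] := et; have /and3P[s2 _ _] := es.
have g_wed k v : contract_at s (wedge k v) =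
  (if position k == s then v else 0) - wedge k (contract_at s v).
  apply/eqP; rewrite eq_sym subr_eq; apply/eqP.
  rewrite /contract_at raddf_sum -big_split /= big_mkcond (bigD1 k) //= contract_wedge.
  rewrite big1 ?addr0 // => l lk; case: ifP => // _; exact: contract_wedge_neq.
rewrite {1}/wedge_edge raddfB /= !contract_at_scale !g_wed positionYW // positionX index_uniq //; last by apply: leq_trans tw; lia.
have -> : (t - 1).+2 = t.+1 by lia.
have /negPf-> : (if is_step t.+1 then t.+1 else 0%N) != s by case: ifP; lia.
rewrite (eq_sym t) /wedge_edge; apply/ffunP => A.
by case: eqP => _; rewrite !ffunE; ring.
Qed.

Lemma contract_at_ext_basis t : contract_at t (ext_basis K set0) = 0.
Proof. by rewrite /contract_at big1 // => k _; apply: contract_ext_basis. Qed.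

Lemma contract_at_path_cycle r s : all is_step r -> is_step s ->
  all (fun t => s < t)%N r -> contract_at s (path_cycle r) = 0.
Proof.
move=> + es; elim: r => [|t r IHr] /=; first by rewrite contract_at_ext_basis.
case/andP=> et er /andP[lt ltr]; rewrite (contract_at_wedge_edge _ et es (ltnW lt)).
by rewrite (ltn_eqF lt) (IHr er ltr) wedge_edge0 subrr.
Qed.

Lemma contract_all_path_cycle r : all is_step r -> sorted ltn r ->
  contract_all r (path_cycle r) =
    scale_by (\prod_(t <- r) 'X_(X (W (t - 2)))) (ext_basis K set0).
Proof.
elim: r => [|t r IHr] /=.
  by move=> _ _; apply/ffunP => A; rewrite [RHS]ffunE big_nil mul1r.
case/andP=> et er; rewrite path_sortedE; last exact: ltn_trans.
case/andP=> lt_t sr; rewrite (contract_at_wedge_edge _ et et (leqnn t)) eqxx (contract_at_path_cycle er et lt_t).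
rewrite wedge_edge0 subr0 contract_all_scale (IHr er sr).
by rewrite scale_byA big_cons.
Qed.

Lemma koszul_d_path_cycle r : all is_step r -> coeffs_in J (koszul_d (path_cycle r)).
Proof.
have Jid : is_ideal J by apply: ideal_gen_is_ideal.
elim: r => [_|t r IHr] /=; first by rewrite koszul_d_ext_basis; apply: coeffs_in0.
case/andP=> et /IHr Jr; rewrite koszul_d_wedge_edge; apply: coeffs_inB => //; last first.
  by rewrite /wedge_edge; apply: coeffs_inB => //; apply: coeffs_in_scale => //;
    apply: coeffs_in_wedge.
move=> A; rewrite ffunE mulrC; case: (Jid) => _ _; apply.
have /and3P[_ _ ee] := et.
set i := W (t - 2) in ee *; set j := W (t - 1) in ee *.
case: (ltngtP i j) => [lt|lt|/val_inj eq]; last by rewrite eq e_irr in ee.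
  apply: ideal_gen_mem; exists i, j; split=> //.
  by rewrite /xvar /yvar [Z in _ - Z]mulrC.
rewrite -opprB; apply: is_idealN => //; apply: ideal_gen_mem; exists j, i.
by split=> //; rewrite 1?e_sym // /xvar /yvar mulrC.
Qed.

Lemma coeffs_homog_wedge c k (u : E) : coeffs_homog c u -> coeffs_homog c (wedge k u).
Proof.
move=> hu A m; rewrite ffunE; case: ifP => [kA|]; last by rewrite mcoeff0 eqxx.
rewrite /koszul_sign -signr_odd; case: odd;
  rewrite ?expr1 ?mulN1r ?mcoeffN ?oppr_eq0 ?mul1r; exact: hu.
Qed.

Lemma coeffs_homog_scaleX c k (u : E) : coeffs_homog c u -> coeffs_homog c.+1 (scale_by 'X_k u).
Proof.
move=> hu A m; rewrite ffunE coeff_XM_if; case: ifP => [gt0 /hu|]; last by rewrite eqxx.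
by rewrite -{2}(mnm_subK gt0) mdegD mdeg1 addn1 => ->.
Qed.

Lemma path_cycle_homog r : coeffs_homog (size r) (path_cycle r).
Proof.
elim: r => [|t r IHr] /=; first exact: ext_basis_homog.
by apply: coeffs_homogB; apply: coeffs_homog_scaleX; apply: coeffs_homog_wedge.
Qed.

Lemma all_is_step : all is_step steps.
Proof. exact: filter_all. Qed.

(** If the cycle were a boundary modulo J_G, contracting and applying the test
    functional would give 1 = 0. *)
Lemma not_koszul_vanish_edge_ideal : ~ koszul_vanish J (size steps).
Proof.
move=> van; have [u Ju] := van (path_cycle steps) (@path_cycle_homog steps) (koszul_d_path_cycle all_is_step).
have sorted_ts : sorted ltn steps.
  by apply: sorted_filter; [exact: ltn_trans | exact: iota_ltn_sorted].
have JG := @coeffs_in_contract_all steps _ Ju;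
  have := test_functional_edge_ideal (JG set0);
  rewrite [contract_all _ _]raddfB coeffs_subE [test_functional _]raddfB /=.
rewrite contract_all_path_cycle ?all_is_step // ffunE ffunE eqxx mulr1 test_functional_diag.
have gkd s v : contract_at s (koszul_d v) =
  - koszul_d (contract_at s v) by apply: contract_at_koszul_d.
suff -> : test_functional (contract_all steps (koszul_d u) set0) = 0.
  by move/eqP; rewrite subr0 oner_eq0.
have kd0 := test_functional_koszul_d (fun t tin => contract_at_all u tin).
case: (contract_all_sign steps gkd u) => eqkd.
  by rewrite -[contract_all steps (koszul_d u)]eqkd.
have -> : contract_all steps (koszul_d u) =
  - koszul_d (contract_all steps u) by rewrite [koszul_d (contract_all steps u)]eqkd opprK.
by rewrite ffunE raddfN /= kd0 oppr0.
Qed.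

End LowerBound.

(** * Gluing longest induced paths of all components *)

Section Forest.
Variables (n : nat) (e : rel 'I_n).
Hypotheses (e_sym : symmetric e) (e_irr : irreflexive e).
Variable d : 'I_n.
Implicit Types (s w : seq 'I_n) (C : {set 'I_n}).

Fixpoint nb_edges w : nat :=
  if w is v :: w' then ((if w' is v' :: _ then e v v' else false) + nb_edges w')%N
  else 0%N.

Definition linear_forest w := forall a b, (a < size w)%N -> (b < size w)%N ->
  e (nth d w a) (nth d w b) -> a = b.+1 \/ b = a.+1.

Lemma nb_edges_sum v w :
  nb_edges (v :: w) = (\sum_(0 <= a < size w) e (nth d (v :: w) a) (nth d (v :: w) a.+1))%N.
Proof.
elim: w v => [|v' w IHw] v; first by rewrite big_geq.
by rewrite [LHS]/= -/(nb_edges (v' :: w)) IHw big_nat_recl.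
Qed.

Lemma size_steps w : size (steps e d w) = nb_edges w.
Proof.
rewrite size_filter -sum1_count big_mkcond -[iota _ _]/(index_iota 0 (size w).+1).
rewrite (eq_bigr (fun t => is_step e d w t : nat)); last by move=> t _; case: is_step.
rewrite big_ltn //; case: w => [|v w]; first by rewrite big_geq.
rewrite big_ltn // nb_edges_sum /is_step /= !add0n.
rewrite -[in LHS](add0n 2%N) -[(size w).+2]addn2 big_addn addnK.
apply: eq_big_nat => a /andP[_ lta].
have -> : (a + 2 - (0 + 2))%N = a by lia.
have -> : (a + 2 - 1)%N = a.+1 by lia.
have -> : (0 + 2 <= a + 2)%N by lia.
by have -> : (a + 2 <= (size w).+1)%N by rewrite addn2 ltnS.
Qed.

Lemma nb_edges_cat w1 w2 : (forall v v', v \in w1 -> v' \in w2 -> ~~ e v v') ->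
  nb_edges (w1 ++ w2) = (nb_edges w1 + nb_edges w2)%N.
Proof.
elim: w1 => //= v w1 IHw ne; rewrite IHw => [|x y xw yw]; last by apply: ne;
  rewrite // inE xw orbT.
rewrite addnA; congr (_ + _ + _)%N; case: w1 {IHw} ne => //= ne.
case: w2 ne => //= v' w2 ne; apply/eqP; rewrite eqb0; apply: ne; exact: mem_head.
Qed.

Lemma nb_edges_path v s : path e v s -> nb_edges (v :: s) = size s.
Proof.
by elim: s v => //= v' s IHs v /andP[-> /IHs ->].
Qed.

(** The single-vertex path shows that the maximum is attained. *)
Lemma longest_path C : C != set0 -> exists w, [/\ uniq w, linear_forest w,
  {subset w <= C} & nb_edges w = longest_induced_path e C].
Proof.
case/set0Pn => v vC; rewrite /longest_induced_path.
pose P (l : 'I_n) := [exists p : l.+1.-tuple 'I_n, induced_path e p && all (fun v => v \in C) p].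
have n_gt0 : (0 < n)%N by apply: leq_ltn_trans (ltn_ord v).
have P0 : P (Ordinal n_gt0).
  apply/existsP; exists [tuple v]; rewrite /induced_path /= vC !andbT.
  by apply/forallP => a; apply/forallP => b; rewrite !ord1 /= (tnth_nth v) e_irr.
have [|l Pl ->] := @eq_bigmax_cond _ P (@nat_of_ord n); first by apply/card_gt0P;
  exists (Ordinal n_gt0).
have /existsP[p /andP[/andP[uniq_p ind_p] inC]] := Pl.
have edge a b : (a < l.+1)%N -> (b < l.+1)%N ->
  e (nth d p a) (nth d p b) = ((b == a.+1) || (a == b.+1)).
  move=> la lb; have /forallP/(_ (Ordinal la))/forallP/(_ (Ordinal lb))/eqP := ind_p.
  by rewrite !(tnth_nth d).
exists p; split=> //.
- move=> a b; rewrite size_tuple => la lb; rewrite edge //.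
  by case/orP => /eqP; [right | left].
- exact/allP.
have : size p = l.+1 by rewrite size_tuple.
case: (tval p) edge => // x s edge [sz]; rewrite nb_edges_path //.
by apply/(pathP d) => i; rewrite sz => li; rewrite (edge i i.+1) ?eqxx // ltnW.
Qed.

Lemma union_of_paths : exists w, [/\ uniq w, linear_forest w &
  nb_edges w = (\sum_(C in components e) longest_induced_path e C)%N].
Proof.
have /and3P[_ triv no0] := components_partition e_sym.
suff [w [uniq_w forest_w _ nb_w]] : exists w, [/\ uniq w, linear_forest w,
    (forall v, v \in w -> exists2 C, C \in enum (components e) & v \in C) &
    nb_edges w = (\sum_(C <- enum (components e)) longest_induced_path e C)%N].
  by exists w; split=> //; rewrite nb_w big_enum.
have : uniq (enum (components e)) by apply: enum_uniq.
have : {subset enum (components e) <= components e} by move=> C; rewrite mem_enum.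
elim: (enum _) => [|C Cs IHCs] sub uniqC.
  by exists [::]; split=> //; rewrite big_nil.
have CP : C \in components e by apply: sub; apply: mem_head.
have /andP[CCs uniqCs] := uniqC.
have [|//|w2 [uniq2 forest2 in2 nb2]] := IHCs.
  by move=> D DCs; apply: sub; rewrite inE DCs orbT.
have [|w1 [uniq1 forest1 in1 nb1]] := @longest_path C.
  by apply: contraNneq no0 => <-.
have sep v v' : v \in w1 -> v' \in w2 -> v' \notin C.
  move=> _ /in2[D DCs v'D]; apply/negP => v'C.
  have DP : D \in components e by apply: sub; rewrite inE DCs orbT.
  move: CCs; rewrite (_ : C = D) ?DCs //.
  by rewrite -(def_pblock triv CP v'C) -(def_pblock triv DP v'D).
have nonedge v v' : v \in w1 -> v' \in w2 -> ~~ e v v'.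
  move=> v1 v2; apply: contra (sep v v' v1 v2) => /connect1.
  by apply: (component_closed CP); apply: in1.
exists (w1 ++ w2); split.
- rewrite cat_uniq uniq1 uniq2 andbT; apply/hasPn => v v2; apply/negP => v1.
  by case/negP: (sep v v v1 v2); apply: in1.
- move=> a b; rewrite size_cat !nth_cat => la lb.
  case: ltnP => a1; case: ltnP => b1.
  + exact: forest1.
  + have b2 : (b - size w1 < size w2)%N by rewrite ltn_subLR.
    by move/negPf: (nonedge _ _ (mem_nth d a1) (mem_nth d b2)) => ->.
  + have a2 : (a - size w1 < size w2)%N by rewrite ltn_subLR.
    by rewrite e_sym; move/negPf: (nonedge _ _ (mem_nth d b1) (mem_nth d a2)) => ->.
  + move=> /forest2; rewrite !ltn_subLR // => /(_ la lb) [|] eq; [left|right].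
      by rewrite -(subnK a1) eq addSn subnK.
    by rewrite -(subnK b1) eq addSn subnK.
- move=> v; rewrite mem_cat => /orP[/in1 vC|/in2[D DCs vD]].
    by exists C => //; apply: mem_head.
  by exists D => //; rewrite inE DCs orbT.
by rewrite nb_edges_cat // big_cons nb1 nb2.
Qed.

End Forest.

Theorem theorem2p2 (K : fieldType) (n : nat) (e : rel 'I_n)
    (e_sym : symmetric e) (e_irr : irreflexive e)
    (e_closed : closed_labeling e) :
  let l := (\sum_(C in components e) longest_induced_path e C)%N in
  is_reg (binomial_edge_ideal K e) (Posz l) /\
  is_reg (in_lex (binomial_edge_ideal K e)) (Posz l).
Proof.
move=> l; set J := binomial_edge_ideal K e.
have Jid : is_ideal J by apply: ideal_gen_is_ideal.
have inid : is_ideal (in_lex J) by apply: ideal_gen_is_ideal.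
have in_lexE f : in_lex J f <-> monomial_ideal (edge_mono e) f by apply: in_lex_edge_ideal.
have van_in c : (l < c)%N -> koszul_vanish (@monomial_ideal K _ (edge_mono e)) c.
  apply: koszul_vanish_edge_mono => //; exact: matching_le_longest.
have van_J c : (l < c)%N -> koszul_vanish J c.
  by case: c => // c lt; apply: koszul_vanish_edge_ideal => //; apply: van_in.
have nvan_J : (0 < l)%N -> ~ koszul_vanish J l.
  (* A list of vertices needs a default vertex; without vertices l is 0. *)
  rewrite lt0n /l; case: (pickP (fun _ : 'I_n => true)) => [d _ _|no]; last first.
    case/negP; rewrite sum_nat_eq0; apply/forall_inP => C _.
    by rewrite /longest_induced_path big1 // => i; have := no i.
  have [w [uniq_w forest_w <-]] := union_of_paths e_sym e_irr d.
  by rewrite -(size_steps e d); apply: not_koszul_vanish_edge_ideal.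
(* For l = 0 the class of 1 in degree 0 has to survive. *)
have coef0_in f : in_lex J f -> f@_0%MM = 0.
  move/in_lexE => Uf; apply/eqP/negPn/negP => /Uf /existsP[p].
  by rewrite /redex mnm0E andbF.
have coef0_J f : J f -> f@_0%MM = 0.
  case=> k [c [a [aJ ->]]]; rewrite raddf_sum big1 //= => t _.
  have [i [j [_ _ ->]]] := aJ t.
  rewrite mulrC mulrBl raddfB /= -!mulrA !coeff_XM_eq0 ?mnm0E ?subrr //.
split; apply: is_reg_of_koszul_vanish => //.
- by case: (posnP l) => [->|/nvan_J //]; apply: not_koszul_vanish0.
- by move=> c lt; apply: eq_koszul_vanish (van_in c lt) => f; split=> /in_lexE.
case: (posnP l) => [->|l_gt0 van]; first exact: not_koszul_vanish0.
apply: (nvan_J l_gt0); move: van; rewrite -(prednK l_gt0) => van.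
by apply: koszul_vanish_edge_ideal => //; apply: eq_koszul_vanish van.
Qed.
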